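(* Let $f\in C(\Omega)\cap L^\infty(\Omega)$ and $g\in C(\partial\Omega)$. There exists an at most countable set $\mathcal{N}\subseteq\mathbb{R}$ such that the problem $$-\Delta_\infty u=f+c\ \text{ in }\Omega,\qquad u=g\ \text{ on }\partial\Omega$$ has a unique viscosity solution $u\in C(\bar\Omega)$ for every $c\in\mathbb{R}\setminus\mathcal{N}$.
   Context: $\Omega\subseteq\mathbb{R}^n$ is a bounded, connected, open set. It is assumed that $\operatorname{diam}(\Omega):=\sup\{d(x,y):x,y\in\bar\Omega\}<\infty$, where $d(x,y)$ is the infimum of the lengths of Lipschitz paths in $\bar\Omega$ joining $x$ to $y$. For a $C^2$ function $\varphi$ near $x$: if $D\varphi(x)\ne0$, $\Delta_\infty^+\varphi(x)=\Delta_\infty^-\varphi(x):=|D\varphi(x)|^{-2}\langle D^2\varphi(x)D\varphi(x),D\varphi(x)\rangle$; if $D\varphi(x)=0$, $\Delta_\infty^+\varphi(x):=\max_{|v|=1}\langle D^2\varphi(x)v,v\rangle$ and $\Delta_\infty^-\varphi(x):=\min_{|v|=1}\langle D^2\varphi(x)v,v\rangle$. For $h\in C(\Omega)$, a continuous $u$ is a viscosity solution of $-\Delta_\infty u=h$ in $\Omega$ if for every polynomial $\varphi$ of degree 2 (at most) and $x_0\in\Omega$: $-\Delta_\infty^+\varphi(x_0)\le h(x_0)$ whenever $u-\varphi$ has a strict local maximum at $x_0$, and $-\Delta_\infty^-\varphi(x_0)\ge h(x_0)$ whenever $u-\varphi$ has a strict local minimum at $x_0$. (Equivalently, one may use all $\varphi\in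 C^2$ and non-strict extrema.) *)

(* Defs.v *)
From HB Require Import structures.
From mathcomp Require Import all_boot all_order all_algebra.
From mathcomp Require Import all_classical all_reals all_analysis.
Set Implicit Arguments.
Unset Strict Implicit.
Unset Printing Implicit Defensive.
Import Order.TTheory GRing.Theory Num.Theory.
Import numFieldNormedType.Exports.
Local Open Scope classical_set_scope.
Local Open Scope ring_scope.

(* The library norm `|_| on 'rV[R]_n is the sup norm; it induces the usual
   topology, bounded sets and Lipschitz maps, but Euclidean lengths need
   [enorm]. *)
Definition dot (R : realType) (n : nat) (u v : 'rV[R]_n) : R :=
  \sum_(i < n) u 0 i * v 0 i.

Definition enorm (R : realType) (n : nat) (u : 'rV[R]_n) : R :=
  Num.sqrt (dot u u).

(* Analogues of [variation] and [total_variation] for vector-valued maps. *)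
Definition path_variation (R : realType) (n : nat) (a b : R)
    (p : R -> 'rV[R]_n) (s : seq R) : R :=
  \sum_(0 <= k < size s) enorm (p (nth b s k) - p (nth b (a :: s) k)).

Definition path_length (R : realType) (n : nat) (a b : R)
    (p : R -> 'rV[R]_n) : \bar R :=
  ereal_sup [set (path_variation a b p s)%:E | s in itv_partition a b].

Definition lipschitz_path (R : realType) (n : nat) (A : set 'rV[R]_n)
    (x y : 'rV[R]_n) (p : R -> 'rV[R]_n) : Prop :=
  [/\ [lipschitz p t | t in `[0, 1]%classic],
      (forall t, `[0, 1]%classic t -> A (p t)),
      p 0 = x & p 1 = y].

(* +oo when no Lipschitz path in A joins x to y. *)
Definition path_dist (R : realType) (n : nat) (A : set 'rV[R]_n)
    (x y : 'rV[R]_n) : \bar R :=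
  ereal_inf [set path_length 0 1 p | p in lipschitz_path A x y].

Definition path_diam (R : realType) (n : nat) (Omega : set 'rV[R]_n) : \bar R :=
  ereal_sup [set path_dist (closure Omega) z.1 z.2
            | z in closure Omega `*` closure Omega].

Definition boundary (R : realType) (n : nat) (A : set 'rV[R]_n)
    : set 'rV[R]_n :=
  closure A `\` interior A.

Definition grad (R : realType) (n : nat) (phi : 'rV[R]_n -> R) (x : 'rV[R]_n)
    : 'rV[R]_n :=
  \row_(i < n) 'D_(delta_mx 0 i) phi x.

Definition hess (R : realType) (n : nat) (phi : 'rV[R]_n -> R) (x : 'rV[R]_n)
    : 'M[R]_n :=
  \matrix_(i < n, j < n)
    'D_(delta_mx 0 i) (fun y => 'D_(delta_mx 0 j) phi y) x.

(* Row-vector convention: v *m A is the transpose of A^T v. *)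
Definition quad_form (R : realType) (n : nat) (A : 'M[R]_n) (v : 'rV[R]_n) : R :=
  dot (v *m A) v.

(* For 0 < n the unit sphere is compact and nonempty, so these sup and inf are
   the max and min over it. *)
Definition max_quad (R : realType) (n : nat) (A : 'M[R]_n) : R :=
  sup [set quad_form A v | v in [set v | enorm v = 1]].

Definition min_quad (R : realType) (n : nat) (A : 'M[R]_n) : R :=
  inf [set quad_form A v | v in [set v | enorm v = 1]].

Definition infty_laplacian_plus (R : realType) (n : nat)
    (phi : 'rV[R]_n -> R) (x : 'rV[R]_n) : R :=
  if grad phi x != 0
  then (enorm (grad phi x)) ^- 2 * quad_form (hess phi x) (grad phi x)
  else max_quad (hess phi x).

Definition infty_laplacian_minus (R : realType) (n : nat)
    (phi : 'rV[R]_n -> R) (x : 'rV[R]_n) : R :=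
  if grad phi x != 0
  then (enorm (grad phi x)) ^- 2 * quad_form (hess phi x) (grad phi x)
  else min_quad (hess phi x).

Definition quadratic_poly (R : realType) (n : nat) (phi : 'rV[R]_n -> R)
    : Prop :=
  exists (a : R) (b : 'rV[R]_n) (M : 'M[R]_n),
    forall y, phi y = a + dot b y + quad_form M y.

Definition strict_local_max (R : realType) (n : nat) (Omega : set 'rV[R]_n)
    (w : 'rV[R]_n -> R) (x0 : 'rV[R]_n) : Prop :=
  \forall x \near x0^', Omega x -> w x < w x0.

Definition strict_local_min (R : realType) (n : nat) (Omega : set 'rV[R]_n)
    (w : 'rV[R]_n -> R) (x0 : 'rV[R]_n) : Prop :=
  \forall x \near x0^', Omega x -> w x0 < w x.

(* u is a viscosity solution of - Delta_infty u = h in Omega. *)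
Definition viscosity_solution (R : realType) (n : nat) (Omega : set 'rV[R]_n)
    (h u : 'rV[R]_n -> R) : Prop :=
  {within Omega, continuous u} /\
  forall (phi : 'rV[R]_n -> R) (x0 : 'rV[R]_n),
    quadratic_poly phi -> Omega x0 ->
    (strict_local_max Omega (fun x => u x - phi x) x0 ->
       - infty_laplacian_plus phi x0 <= h x0) /\
    (strict_local_min Omega (fun x => u x - phi x) x0 ->
       - infty_laplacian_minus phi x0 >= h x0).

(* Functions on a subset of R^n are represented by total functions; only the
   values of u on the closure of Omega are constrained. *)
Definition dirichlet_solution (R : realType) (n : nat) (Omega : set 'rV[R]_n)
    (h g u : 'rV[R]_n -> R) : Prop :=
  [/\ {within closure Omega, continuous u},
      viscosity_solution Omega h u
    & forall x, boundary Omega x -> u x = g x].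

(* Main.v *)
Require Import Defs.
From HB Require Import structures.
From mathcomp Require Import all_boot all_order all_algebra.
From mathcomp Require Import all_classical all_reals all_analysis.
From mathcomp Require Import ring lra.
Import Order.TTheory GRing.Theory Num.Theory.
Import numFieldNormedType.Exports.
Local Open Scope classical_set_scope.
Local Open Scope ring_scope.
Set Implicit Arguments.
Unset Strict Implicit.
Unset Printing Implicit Defensive.

(** The exceptional set is countable because solutions are ordered by
    [c]: if [c < c'], solutions [u] and [v] for the right-hand sides [f + c]
    and [f + c'] satisfy [u <= v] ([dirichlet_comparison]). When the problem
    for [c] has two solutions, they differ at an interior point, so by
    continuity a rational number lies strictly between their values at some
    point with rational coordinates. By the ordering two different [c] cannot
    produce the same pair (point, number) ([separated_inj]), and there are
    countably many pairs. It remains to prove the ordering, and the existence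
    of a solution for every [c].

    Both rest on comparison with cones ([cone_comparison]). The function
    [c + a r - (b/2) r^2] of the distance [r] to a fixed vertex satisfies
    [-Delta_infty = b] where it increases, and at each such point a quadratic
    polynomial with the same gradient and the same second derivative along the
    gradient touches it from above. A subsolution with [h < b] therefore
    cannot touch it from below.

    Ordering. Comparison with cones gives, for a subsolution with [h < b] on
    the ball of radius [2 eps] around [x], the finite difference inequality
    [2 max_{B(x, eps)} u <= u x + max_{B(x, 2 eps)} u + b eps^2]
    ([midpoint_le]). Suppose [u - v] is positive somewhere, and let [(y, z)]
    almost maximize [u y - v z] among the pairs at distance at most [2 eps].
    Writing the inequality for [u] and for [- v] at the midpoint of [y] and
    [z], and bounding the right-hand sides by the almost maximal value, leaves
    [0 <= (b - b') eps^2] up to a smaller error, where [b < b'] separate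
    [f + c] and [f + c'] nearby; this is absurd ([strict_comparison]).

    Existence is Perron's method: take the supremum of the subsolutions that
    are continuous on the closure, below [g] on the boundary, and bounded
    below by a fixed constant. Cones with vertex at interior points give these
    functions a common local Lipschitz constant ([perron_lipschitz]). As the
    domain is bounded, cones with vertex at a boundary point are barriers
    there ([perron_boundary]). So the supremum is continuous up to the
    boundary, with boundary values [g]. It is a subsolution since a quadratic
    touching it also touches, up to a small change, a nearly optimal member of
    the family ([perron_subsolution]), and a supersolution since otherwise a
    small quadratic bump would enlarge it inside the family
    ([perron_supersolution]). *)

(** * The Euclidean norm and its topology *)

Section Euclid.
Variables (R : realType) (n : nat).
Implicit Types (u v w x y z p : 'rV[R]_n) (A B M : 'M[R]_n) (t a b : R).

Lemma dotE u v : dot u v = (u *m v^T) 0 0.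
Proof. by rewrite mxE; apply: eq_bigr => i _; rewrite mxE. Qed.

Lemma dotC u v : dot u v = dot v u.
Proof. by apply: eq_bigr => i _; rewrite mulrC. Qed.

Lemma dotDl u v w : dot (u + v) w = dot u w + dot v w.
Proof. by rewrite !dotE mulmxDl mxE. Qed.

Lemma dotZl t u v : dot (t *: u) v = t * dot u v.
Proof. by rewrite !dotE -scalemxAl mxE. Qed.

Lemma dotNl u v : dot (- u) v = - dot u v.
Proof. by rewrite -scaleN1r dotZl mulN1r. Qed.

Lemma dot0l u : dot 0 u = 0.
Proof. by rewrite -(scale0r 0) dotZl mul0r. Qed.

Lemma dotDr u v w : dot u (v + w) = dot u v + dot u w.
Proof. by rewrite !(dotC u) dotDl. Qed.

Lemma dotZr t u v : dot u (t *: v) = t * dot u v.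
Proof. by rewrite !(dotC u) dotZl. Qed.

Lemma dotNr u v : dot u (- v) = - dot u v.
Proof. by rewrite !(dotC u) dotNl. Qed.

Lemma dot0r u : dot u 0 = 0.
Proof. by rewrite dotC dot0l. Qed.

Lemma dotvv_ge0 u : 0 <= dot u u.
Proof. by apply: sumr_ge0 => i _; rewrite -expr2 sqr_ge0. Qed.

Lemma dotvv_eq0 u : (dot u u == 0) = (u == 0).
Proof.
apply/eqP/eqP => [/eqP|->]; last by rewrite dot0l.
rewrite psumr_eq0 => [/allP h|i _]; last by rewrite -expr2 sqr_ge0.
apply/rowP => i; rewrite mxE; apply/eqP.
by have := h i (mem_index_enum _); rewrite mulf_eq0 orbb.
Qed.

Lemma dotvv_gt0 u : (0 < dot u u) = (u != 0).
Proof. by rewrite lt_def dotvv_ge0 andbT dotvv_eq0. Qed.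

Lemma sqr_enorm u : enorm u ^+ 2 = dot u u.
Proof. by rewrite sqr_sqrtr ?dotvv_ge0. Qed.

Lemma enorm_ge0 u : 0 <= enorm u.
Proof. exact: sqrtr_ge0. Qed.

Lemma enorm0 : enorm (0 : 'rV[R]_n) = 0.
Proof. by rewrite /enorm dot0l sqrtr0. Qed.

Lemma enorm_gt0 u : (0 < enorm u) = (u != 0).
Proof. by rewrite sqrtr_gt0 dotvv_gt0. Qed.

Lemma enormN u : enorm (- u) = enorm u.
Proof. by rewrite /enorm dotNl dotNr opprK. Qed.

Lemma enormBC u v : enorm (u - v) = enorm (v - u).
Proof. by rewrite -enormN opprB. Qed.

Lemma enormZ t u : enorm (t *: u) = `|t| * enorm u.
Proof.
by rewrite /enorm dotZl dotZr mulrA -expr2 sqrtrM ?sqr_ge0 // sqrtr_sqr.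
Qed.

Lemma dot_le_enorm u v : dot u v <= enorm u * enorm v.
Proof.
have [->|v0] := eqVneq v 0; first by rewrite dot0r enorm0 mulr0.
have vv : 0 < dot v v by rewrite dotvv_gt0.
have := dotvv_ge0 (dot v v *: u - dot u v *: v).
rewrite !(dotDl, dotDr, dotNl, dotNr, dotZl, dotZr) (dotC v u) => h.
have {h} : dot u v ^+ 2 <= dot u u * dot v v.
  rewrite -(ler_pM2l vv) -subr_ge0; apply: le_trans h _.
  by rewrite le_eqVlt; apply/orP; left; apply/eqP; ring.
rewrite -!sqr_enorm -exprMn => h.
apply: le_trans (ler_norm _) _.
rewrite -(@ler_pXn2r _ 2) ?nnegrE ?mulr_ge0 ?enorm_ge0 //.
by rewrite real_normK ?num_real.
Qed.

Lemma ler_enormD u v : enorm (u + v) <= enorm u + enorm v.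
Proof.
rewrite -(@ler_pXn2r _ 2) ?nnegrE ?addr_ge0 ?enorm_ge0 //.
rewrite sqr_enorm !(dotDl, dotDr) (dotC v u) -!sqr_enorm.
by have := dot_le_enorm u v; nra.
Qed.

Lemma ler_distD_enorm z x y : enorm (x - y) <= enorm (x - z) + enorm (z - y).
Proof. by apply: le_trans (ler_enormD _ _); rewrite addrA subrK. Qed.

Lemma ler_coord_norm v i : `|v 0 i| <= `|v|.
Proof.
have /mapP[j Hj ->] : `|v 0 i| \in [seq `|v x.1 x.2| | x : 'I_1 * 'I_n].
  by apply/mapP; exists (0, i) => //=; rewrite mem_enum.
rewrite [leRHS]/Num.norm /= mx_normrE; apply/bigmax_geP; right => /=.
by exists j.
Qed.

Lemma ler_coord_enorm v i : `|v 0 i| <= enorm v.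
Proof.
rewrite -(@ler_pXn2r _ 2) ?nnegrE ?enorm_ge0 // sqr_enorm.
rewrite real_normK ?num_real //.
rewrite /dot (bigD1 i) //= -expr2 lerDl.
by apply: sumr_ge0 => j _; rewrite -expr2 sqr_ge0.
Qed.

Lemma ler_norm_enorm v : `|v| <= enorm v.
Proof.
rewrite [leLHS]/Num.norm /= mx_normrE; apply: bigmax_le; first exact: enorm_ge0.
by move=> [i j] _ /=; rewrite (ord1 i); exact: ler_coord_enorm.
Qed.

Lemma ler_enorm_norm v : enorm v <= n%:R * `|v|.
Proof.
rewrite -(@ler_pXn2r _ 2) ?nnegrE ?mulr_ge0 ?enorm_ge0 // sqr_enorm.
apply: (@le_trans _ _ (\sum_(i < n) `|v| ^+ 2)).
  apply: ler_sum => i _; rewrite -expr2 -real_normK ?num_real //.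
  by rewrite ler_pXn2r ?nnegrE // ler_coord_norm.
rewrite sumr_const card_ord exprMn -[leLHS]mulr_natl.
apply: ler_wpM2r; first exact: sqr_ge0.
by rewrite -natrX ler_nat; case: (n) => // m; rewrite leq_pmull.
Qed.

(** The library topology comes from the sup norm; this and the next lemma move
    all later arguments to Euclidean balls. *)
Lemma nbhs_enormP x (P : set 'rV[R]_n) :
  nbhs x P <-> exists2 r, 0 < r & forall y, enorm (y - x) < r -> P y.
Proof.
split=> [/nbhs_ballP[r /= r0 h]|[r r0 h]].
  exists r => // y yr; apply: h; rewrite -ball_normE /=.
  by rewrite -normrN opprB (le_lt_trans (ler_norm_enorm _)).
apply/nbhs_ballP; exists (r / n.+1%:R) => /=; first by rewrite divr_gt0.
move=> y; rewrite -ball_normE /= -normrN opprB ltr_pdivlMr // => yr.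
apply: h; apply: le_lt_trans yr; apply: le_trans (ler_enorm_norm _) _.
by rewrite mulrC ler_wpM2l // ler_nat.
Qed.

Lemma continuous_withinP (A : set 'rV[R]_n) (u : 'rV[R]_n -> R) :
  {within A, continuous u} <->
  forall x, A x -> forall e, 0 < e ->
    exists2 d, 0 < d & forall y, A y -> enorm (y - x) < d -> `|u y - u x| < e.
Proof.
split=> [/subspace_continuousP h x Ax e e0|h].
  have /cvgrPdist_lt /(_ e e0) := h x Ax.
  rewrite near_withinE => /nbhs_enormP[d d0 hd]; exists d => // y Ay yd.
  by rewrite distrC; exact: hd.
apply/subspace_continuousP => x Ax; apply/cvgrPdist_lt => e e0.
rewrite near_withinE; have [d d0 hd] := h x Ax e e0.
by apply/nbhs_enormP; exists d => // y yd Ay; rewrite distrC; exact: hd.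
Qed.

End Euclid.

(** * Quadratic forms *)

Section QuadraticForms.
Variables (R : realType) (n : nat).
Implicit Types (u v w x y z p : 'rV[R]_n) (A B M : 'M[R]_n) (t a b : R).

Lemma quad_formE M v : quad_form M v = (v *m M *m v^T) 0 0.
Proof. exact: dotE. Qed.

Lemma quad_formDl A B v : quad_form (A + B) v = quad_form A v + quad_form B v.
Proof. by rewrite /quad_form mulmxDr dotDl. Qed.

Lemma quad_formZl t A v : quad_form (t *: A) v = t * quad_form A v.
Proof. by rewrite /quad_form -scalemxAr dotZl. Qed.

Lemma quad_formNl A v : quad_form (- A) v = - quad_form A v.
Proof. by rewrite -scaleN1r quad_formZl mulN1r. Qed.

Lemma quad_form1 v : quad_form 1%:M v = dot v v.
Proof. by rewrite /quad_form mulmx1. Qed.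

Lemma quad_form_rank1 p v : quad_form (p^T *m p) v = dot p v ^+ 2.
Proof.
rewrite quad_formE !mulmxA -mulmxA mxE big_ord1 -!dotE.
by rewrite (dotC v p) -expr2.
Qed.

Lemma dot_mulmx v w A : dot (v *m A) w = dot (w *m A^T) v.
Proof.
have e : w *m A^T *m v^T = (v *m A *m w^T)^T by rewrite !trmx_mul trmxK mulmxA.
by rewrite !dotE e [RHS]mxE.
Qed.

Lemma quad_form_tr A v : quad_form A^T v = quad_form A v.
Proof. by rewrite /quad_form dot_mulmx trmxK. Qed.

Lemma quad_form_sym A v : quad_form (A + A^T) v = 2 * quad_form A v.
Proof. by rewrite quad_formDl quad_form_tr; ring. Qed.

Lemma quad_formZr t A v : quad_form A (t *: v) = t ^+ 2 * quad_form A v.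
Proof. by rewrite /quad_form -scalemxAl dotZl dotZr mulrA. Qed.

Lemma quad_formNr A v : quad_form A (- v) = quad_form A v.
Proof. by rewrite -scaleN1r quad_formZr sqrrN expr1n mul1r. Qed.

Lemma quad_form0 A : quad_form A 0 = 0.
Proof. by rewrite /quad_form dot0r. Qed.

Lemma quad_formDr A v w :
  quad_form A (v + w) = quad_form A v + dot (v *m (A + A^T)) w + quad_form A w.
Proof.
rewrite /quad_form mulmxDl mulmxDr !dotDl !dotDr.
rewrite (dot_mulmx w v A); ring.
Qed.

Lemma quad_form_le_unit A :
  exists C, forall v, enorm v = 1 -> quad_form A v <= C.
Proof.
exists (n%:R * \sum_(i < n) \sum_(j < n) `|A i j|) => v v1.
have vi i : `|v 0 i| <= 1 by rewrite -v1 ler_coord_enorm.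
have vA i : `|(v *m A) 0 i| <= \sum_(i < n) \sum_(j < n) `|A i j|.
  rewrite mxE; apply: le_trans (ler_norm_sum _ _ _) _; apply: ler_sum => j _.
  rewrite normrM (bigD1 i) //= -[leLHS]addr0 lerD ?sumr_ge0 //.
  by rewrite -[leRHS]mul1r ler_wpM2r.
apply: (@le_trans _ _ (\sum_(k < n) \sum_(i < n) \sum_(j < n) `|A i j|)).
  apply: ler_sum => i _; apply: le_trans (ler_norm _) _; rewrite normrM.
  apply: le_trans (vA i); rewrite -[leRHS]mulr1 ler_wpM2l //.
by rewrite sumr_const card_ord mulr_natl.
Qed.

End QuadraticForms.

(** * Viscosity inequalities through touching quadratics *)

Section Viscosity.
Variables (R : realType) (n : nat).
Implicit Types (v w x y z p b xi : 'rV[R]_n) (A B M : 'M[R]_n) (t a c eta : R).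
Implicit Types (h f u phi : 'rV[R]_n -> R) (Omega : set 'rV[R]_n).

Definition quad_poly a b M : 'rV[R]_n -> R :=
  fun y => a + dot b y + quad_form M y.

Lemma quad_poly_taylor a b M x w :
  quad_poly a b M (x + w) =
  quad_poly a b M x + dot (b + x *m (M + M^T)) w + quad_form M w.
Proof. by rewrite /quad_poly quad_formDr dotDr dotDl; ring. Qed.

Lemma trmx_symm M : (M + M^T)^T = M + M^T.
Proof. by rewrite linearD /= trmxK addrC. Qed.

Lemma quad_poly_center c xi M x : exists a b,
  b + x *m (M + M^T) = xi /\
  forall y, c + dot xi (y - x) + quad_form M (y - x) = quad_poly a b M y.
Proof.
exists (c - dot xi x + quad_form M x), (xi - x *m (M + M^T)).
split=> [|y]; first by rewrite subrK.
rewrite /quad_poly quad_formDr quad_formNr !dotDr !dotNr dotDl dotNl.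
rewrite (dot_mulmx x y) trmx_symm; ring.
Qed.

Lemma derive_quad_poly a b M x v :
  'D_v (quad_poly a b M) x = dot (b + x *m (M + M^T)) v.
Proof.
rewrite /derive; apply: cvg_lim => //; set d := dot _ v.
have c0 : d + t * quad_form M v @[t --> (0 : R)] --> d + 0 * quad_form M v.
  by apply: cvgD; [exact: cvg_cst|apply: cvgM => //; exact: cvg_cst].
rewrite mul0r addr0 in c0.
have c1 : d + t * quad_form M v @[t --> (0 : R)^'] --> d.
  exact: cvg_within_filter.
apply: cvg_trans c1; apply: near_eq_cvg; rewrite /dnbhs near_withinE.
apply: nearW => t t0 /=.
rewrite (addrC _ x) quad_poly_taylor quad_formZr dotZr -/d /GRing.scale /=.
by field.
Qed.

Lemma dot_delta v i : dot v (delta_mx 0 i) = v 0 i.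
Proof. by rewrite dotE trmx_delta -colE mxE. Qed.

Lemma grad_quad_poly a b M x : grad (quad_poly a b M) x = b + x *m (M + M^T).
Proof. by apply/rowP => i; rewrite mxE derive_quad_poly dot_delta. Qed.

Lemma hess_quad_poly a b M x : hess (quad_poly a b M) x = M + M^T.
Proof.
apply/matrixP => i j; rewrite mxE; set S := M + M^T.
have -> : (fun y => 'D_(delta_mx 0 j) (quad_poly a b M) y) =
    quad_poly (dot b (delta_mx 0 j)) (delta_mx 0 j *m S^T) 0.
  apply/funext => y; rewrite derive_quad_poly dotDl dot_mulmx /quad_poly.
  by rewrite -[X in quad_form X](scale0r 0) quad_formZl mul0r addr0.
rewrite derive_quad_poly trmx0 addr0 mulmx0 addr0 dot_mulmx trmxK.
by rewrite dot_delta -rowE mxE.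
Qed.

Lemma quadratic_polyP phi : quadratic_poly phi ->
  exists a b M, phi = quad_poly a b M.
Proof. by move=> [a [b [M e]]]; exists a, b, M; apply/funext. Qed.

Lemma quadratic_poly_quad_poly a b M : quadratic_poly (quad_poly a b M).
Proof. by exists a, b, M. Qed.

Lemma quad_polyN a b M : - quad_poly a b M = quad_poly (- a) (- b) (- M).
Proof.
by apply/funext => y; rewrite /quad_poly /= dotNl quad_formNl !opprD.
Qed.

Lemma quadratic_polyN phi : quadratic_poly phi -> quadratic_poly (- phi).
Proof.
move=> /quadratic_polyP[a [b [M ->]]]; rewrite quad_polyN.
exact: quadratic_poly_quad_poly.
Qed.

Lemma infty_laplacian_minusN phi x : quadratic_poly phi ->
  infty_laplacian_minus phi x = - infty_laplacian_plus (- phi) x.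
Proof.
move=> /quadratic_polyP[a [b [M ->]]]; rewrite quad_polyN.
rewrite /infty_laplacian_minus /infty_laplacian_plus !grad_quad_poly.
rewrite !hess_quad_poly linearN /= -opprD mulmxN -opprD oppr_eq0.
case: ifP => _; first by rewrite enormN quad_formNl quad_formNr mulrN opprK.
rewrite /min_quad /max_quad /inf image_comp; congr (- sup (_ @` _)).
by apply/funext => v /=; rewrite quad_formNl.
Qed.

(** For [xi = 0] the slack [eta] is what lets a near-maximizer of the
    quadratic form on the unit sphere serve as [v]. *)
Lemma infty_laplacian_plus_leP a b M x c : (0 < n)%N ->
  - infty_laplacian_plus (quad_poly a b M) x <= c <->
  forall eta, 0 < eta -> exists v t,
    [/\ v != 0, 0 <= t, b + x *m (M + M^T) = t *: v &
        0 <= 2 * quad_form M v + (c + eta) * dot v v].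
Proof.
move=> n_gt0; rewrite /infty_laplacian_plus grad_quad_poly hess_quad_poly.
set xi := b + _; case: (eqVneq xi 0) => [xi0|xi0] /=; last first.
  rewrite quad_form_sym sqr_enorm.
  have xx : 0 < dot xi xi by rewrite dotvv_gt0.
  split=> [h eta eta0|h].
    exists xi, 1; split=> //; first by rewrite scale1r.
    move: h; rewrite lerNl mulrC ler_pdivlMr // => h.
    by have := mulr_gt0 eta0 xx; lra.
  apply/ler_addgt0Pr => eta eta0; have [v [t [v0 t0 e q]]] := h _ eta0.
  rewrite lerNl mulrC ler_pdivlMr // e quad_formZr dotZl dotZr.
  by have := mulr_ge0 (sqr_ge0 t) q; lra.
have [C hC] := quad_form_le_unit (M + M^T).
split=> [h eta eta0|h].
  have hs : has_sup [set quad_form (M + M^T) v | v in [set v | enorm v = 1]].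
    split; last by exists C => _ [v v1 <-]; exact: hC.
    pose e := delta_mx 0 (Ordinal n_gt0) : 'rV[R]_n.
    exists (quad_form (M + M^T) e), e => //=.
    by rewrite /enorm dot_delta mxE !eqxx sqrtr1.
  have [_ [v v1 <-] hv] := sup_adherent eta0 hs.
  exists v, 0; split=> //; first by rewrite -enorm_gt0 v1.
    by rewrite scale0r.
  rewrite -quad_form_sym -sqr_enorm v1 expr1n mulr1.
  move: h hv; rewrite /max_quad; lra.
apply/ler_addgt0Pr => eta eta0; have [v [t [v0 t0 e q]]] := h _ eta0.
have nv : 0 < enorm v by rewrite enorm_gt0.
set w := (enorm v)^-1 *: v.
have hw : quad_form (M + M^T) w <= max_quad (M + M^T).
  apply: ub_le_sup; first by exists C => _ [z z1 <-]; exact: hC.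
  exists w => //=; rewrite enormZ ger0_norm ?invr_ge0 ?enorm_ge0 //.
  by rewrite mulVf // gt_eqF.
suff : - quad_form (M + M^T) w <= c + eta by lra.
move: q; rewrite /w quad_formZr quad_form_sym -sqr_enorm => q.
rewrite exprVn lerNl mulrC ler_pdivlMr ?exprn_gt0 //; lra.
Qed.

Definition touches_above u x xi M : Prop :=
  \forall y \near x, u y <= u x + dot xi (y - x) + quad_form M (y - x).

(** The inequality [-Delta_infty^+ phi <= h] for the touching quadratic [phi]
    (Hessian [M + M^T]), uniformly in whether the gradient [xi] vanishes: if
    [xi != 0] then [v] is a positive multiple of [xi], and if [xi = 0] then
    [t = 0] and [v] ranges over all directions, as in the maximum defining
    [Delta_infty^+]. The slack [eta] absorbs both the strictness of the
    extrema in the viscosity definition and the supremum over unit vectors.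
    Supersolutions for [h] are functions [u] with [- u] a subsolution for
    [- h]. *)
Definition subsolution Omega h u : Prop :=
  forall x xi M, Omega x -> touches_above u x xi M ->
  forall eta, 0 < eta -> exists v t,
    [/\ v != 0, 0 <= t, xi = t *: v &
        0 <= 2 * quad_form M v + (h x + eta) * dot v v].

(** A touching quadratic becomes a strict one after adding a small multiple of
    the squared distance, whose effect on the Hessian fits in [eta]. *)
Lemma subsolutionP Omega h u : (0 < n)%N -> open Omega ->
  (forall phi x, quadratic_poly phi -> Omega x ->
     strict_local_max Omega (fun y => u y - phi y) x ->
     - infty_laplacian_plus phi x <= h x) <->
  subsolution Omega h u.
Proof.
move=> n_gt0 oO; split=> [su x xi M Ox tu eta eta0|su phi x].
  (* adding [q 1] to [M] adds [2 q] to the second derivatives: [2 q = eta/2] *)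
  pose M' := M + (eta / 4) *: 1%:M.
  have QM' w : quad_form M' w = quad_form M w + eta / 4 * dot w w.
    by rewrite quad_formDl quad_formZl quad_form1.
  have [a [b [bE qE]]] := quad_poly_center (u x) xi M' x.
  have := su _ x (quadratic_poly_quad_poly a b M') Ox.
  have smax : strict_local_max Omega (fun y => u y - quad_poly a b M' y) x.
    rewrite /strict_local_max /dnbhs near_withinE; near=> y => /= yx Oy.
    rewrite -!qE subrr dot0r quad_form0 QM'.
    have : 0 < dot (y - x) (y - x) by rewrite dotvv_gt0 subr_eq0.
    have : u y <= u x + dot xi (y - x) + quad_form M (y - x) by near: y.
    by move=> uy /(mulr_gt0 eta0); lra.
  move=> /(_ smax)/(infty_laplacian_plus_leP a b M' x (h x) n_gt0).
  move=> /(_ (eta / 2)).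
  rewrite bE; case=> [|v [t [v0 t0 e]]]; first lra.
  by rewrite QM' => q; exists v, t; split=> //; lra.
move=> /quadratic_polyP[a [b [M ->]]] Ox smax.
apply/infty_laplacian_plus_leP => //; apply: su => //.
move: smax; rewrite /strict_local_max /dnbhs near_withinE => smax.
have nO : nbhs x Omega by exact: open_nbhs_nbhs.
near=> y; have [->|yx] := eqVneq y x.
  by rewrite subrr dot0r quad_form0 !addr0.
have Oy : Omega y by near: y.
have : y != x -> Omega y -> u y - quad_poly a b M y < u x - quad_poly a b M x.
  by near: y.
move=> /(_ yx Oy); have := quad_poly_taylor a b M x (y - x).
by rewrite (addrC x) subrK; lra.
Unshelve. all: by end_near.
Qed.

Lemma viscosity_solutionP Omega h u : (0 < n)%N -> open Omega ->
  viscosity_solution Omega h u <->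
  [/\ {within Omega, continuous u}, subsolution Omega h u &
      subsolution Omega (- h) (- u)].
Proof.
move=> n_gt0 oO; split=> [[cu uh]|[cu /subsolutionP-/(_ n_gt0 oO) s1]].
  split=> //; apply/subsolutionP => // phi x qphi Ox smax.
    exact: (uh phi x qphi Ox).1.
  have [_] := uh (- phi) x (quadratic_polyN qphi) Ox.
  rewrite infty_laplacian_minusN; last exact: quadratic_polyN.
  rewrite !opprK => h2.
  rewrite [leRHS]/(- h x) lerN2; apply: h2; apply: filterS smax => y hy Oy.
  by have := hy Oy; rewrite !fctE; lra.
move=> /subsolutionP-/(_ n_gt0 oO) s2; split=> // phi x qphi Ox.
split=> [|smin]; first exact: s1.
have := s2 (- phi) x (quadratic_polyN qphi) Ox.
rewrite infty_laplacian_minusN // opprK => h2.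
rewrite -lerN2; apply: h2; apply: filterS smin => y hy Oy.
by have := hy Oy; rewrite !fctE; lra.
Qed.

End Viscosity.

(** * Quadratics touching cones *)

Section Cones.
Variables (R : realType) (n : nat).
Implicit Types (v w x y z p b xi : 'rV[R]_n) (A B M : 'M[R]_n) (t a c eta : R).
Implicit Types (h f u phi : 'rV[R]_n -> R) (Omega : set 'rV[R]_n).

(** Evaluating at [t] and [- t] isolates the quadratic coefficient; evaluating
    at [t = s al] with [s] small then leaves [s al^2 (1 + s be) > 0]. *)
Lemma quadratic_le0_near0 (d al be : R) : 0 < d ->
  (forall t, `|t| < d -> t * al + t ^+ 2 * be <= 0) -> al = 0 /\ be <= 0.
Proof.
move=> d0 H; split; last first.
  have d2 : `|d / 2| < d by rewrite ger0_norm; lra.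
  have h1 := H _ d2; rewrite -normrN in d2; have h2 := H _ d2.
  have : (d / 2) ^+ 2 * be <= 0 by lra.
  by rewrite pmulr_rle0 // exprn_gt0; lra.
apply/eqP; apply/negPn/negP => al0.
have be0 : 0 <= `|be| by []. have al1 : 0 < `|al| by rewrite normr_gt0.
have D0 : 0 < 1 + `|al| + d * `|be| by nra.
pose s := d / (1 + `|al| + d * `|be|).
have s0 : 0 < s by exact: divr_gt0.
have sE : s * (1 + `|al| + d * `|be|) = d by rewrite divfK // gt_eqF.
have sal : `|s * al| < d by rewrite normrM gtr0_norm //; nra.
have a2 : 0 < al ^+ 2 by rewrite exprn_even_gt0.
have : 0 < s * al ^+ 2 * (1 + s * be).
  apply: mulr_gt0; first exact: mulr_gt0.
  have s1 : s * `|be| < 1 by rewrite -(ltr_pM2l d0); nra.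
  have : s * - `|be| <= s * be by rewrite ler_pM2l // lerNl ler_normr lexx orbT.
  lra.
by have := H _ sal; nra.
Qed.

Lemma quadratics_le_near x xi xi' M M' :
  (\forall y \near x, dot xi (y - x) + quad_form M (y - x) <=
                      dot xi' (y - x) + quad_form M' (y - x)) ->
  xi = xi' /\ forall v, quad_form M v <= quad_form M' v.
Proof.
move=> /nbhs_enormP[r r0 H].
have K v : dot xi v - dot xi' v = 0 /\ quad_form M v - quad_form M' v <= 0.
  have [->|v0] := eqVneq v 0; first by rewrite !dot0r !quad_form0 !subrr.
  have ev : 0 < enorm v by rewrite enorm_gt0.
  apply: (@quadratic_le0_near0 (r / enorm v)); first exact: divr_gt0.
  move=> t; rewrite ltr_pdivlMr // -enormZ => tr.
  have := H (x + t *: v); rewrite addrAC subrr add0r => /(_ tr).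
  by rewrite !dotZr !quad_formZr; nra.
split=> [|v]; last by have [_] := K v; rewrite subr_le0.
apply/eqP; rewrite -subr_eq0 -dotvv_eq0 dotDl dotNl.
by have [-> _] := K (xi - xi').
Qed.

(** A function squeezed at [x] between two quadratics inherits the inequality
    of the lower one: the gradients agree and the upper Hessian dominates.
    This is how explicit functions are shown to be subsolutions. *)
Lemma touched_below_subsolution_at x h xi M xi1 M1 u : (0 < n)%N ->
  touches_above (- u) x (- xi) (- M) ->
  (forall v t, v != 0 -> 0 <= t -> xi = t *: v ->
     0 <= 2 * quad_form M v + h x * dot v v) ->
  touches_above u x xi1 M1 ->
  forall eta, 0 < eta -> exists v t,
    [/\ v != 0, 0 <= t, xi1 = t *: v &
        0 <= 2 * quad_form M1 v + (h x + eta) * dot v v].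
Proof.
move=> n_gt0 below H above eta eta0.
have [exi QM] : xi = xi1 /\ forall v, quad_form M v <= quad_form M1 v.
  apply: (@quadratics_le_near x); near=> y.
  have : u y <= u x + dot xi1 (y - x) + quad_form M1 (y - x) by near: y.
  have : (- u) y <= (- u) x + dot (- xi) (y - x) + quad_form (- M) (y - x).
    by near: y.
  by rewrite !fctE dotNl quad_formNl; lra.
have [v [t [v0 t0 e]]] : exists v t, [/\ v != 0, 0 <= t & xi = t *: v].
  have [xi0|xi0] := eqVneq xi 0; last by exists xi, 1; rewrite scale1r.
  exists (delta_mx 0 (Ordinal n_gt0)), 0; rewrite scale0r; split=> //.
  by rewrite -dotvv_gt0 dot_delta mxE !eqxx.
exists v, t; split=> //; first by rewrite -exi.
have := H v t v0 t0 e; have := QM v; have := mulr_ge0 (ltW eta0) (dotvv_ge0 v).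
lra.
Unshelve. all: by end_near.
Qed.

(** Along rays from [z] this has second derivative [- b]; it is a paraboloid
    when [a = 0]. *)
Definition cone (c a b : R) z y : R :=
  c + a * enorm (y - z) - b / 2 * enorm (y - z) ^+ 2.

Lemma continuous_enorm z : continuous (fun y => enorm (y - z)).
Proof.
move=> x; apply/(@cvgrPdist_lt _ _ _ _ (nbhs_filter x)) => e e0.
apply/nbhs_enormP; exists e => // y yx.
apply: le_lt_trans yx; rewrite ler_norml.
have := ler_distD_enorm y x z; have := ler_distD_enorm x y z.
by rewrite (enormBC x y); lra.
Qed.

Lemma continuous_cone c a (b : R) z : continuous (cone c a b z).
Proof.
move=> x; have ce : {for x, continuous (fun y => enorm (y - z))}.
  exact: continuous_enorm.
have cc k : {for x, continuous (fun=> k : R)} by exact: cst_continuous.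
apply: (continuousB (f := fun y => c + a * enorm (y - z))
  (g := fun y => b / 2 * enorm (y - z) ^+ 2)).
  apply: (continuousD (f := fun=> c) (g := fun y => a * enorm (y - z))) => //.
  exact: (continuousM (s := fun=> a)).
apply: (continuousM (s := fun=> b / 2)) => //.
exact: (continuousM (s := fun y => enorm (y - z))).
Qed.

(** With [e = p / r], split [p + w] into its component [s = r + <e, w>] along
    [e] and an orthogonal part of squared length [T = |w|^2 - <e, w>^2]. Then
    [|p + w| = sqrt (s^2 + T) <= s + T / (2 s) <= s + T / r] as soon as
    [s >= r / 2], and this quadratic has second derivative [0] along [p]. *)
Lemma enorm_touched_above p : p != 0 ->
  let r := enorm p in
  \forall w \near (0 : 'rV[R]_n),
  enorm (p + w) <= r + dot (r^-1 *: p) w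
    + quad_form (r^-1 *: (1%:M - (r ^-2) *: (p^T *m p))) w.
Proof.
move=> p0 r; have r0 : 0 < r by rewrite enorm_gt0.
have r2 : dot p p = r ^+ 2 by rewrite sqr_enorm.
apply/nbhs_enormP; exists (r / 2); first by lra.
move=> w; rewrite subr0 => wr.
rewrite quad_formZl quad_formDl quad_formNl quad_formZl quad_form1.
rewrite quad_form_rank1 dotZl.
set s := dot p w; set q := dot w w.
have qE : q = enorm w ^+ 2 by rewrite sqr_enorm.
have sq : s <= r * enorm w by exact: dot_le_enorm.
have sq' : - s <= r * enorm w.
  by rewrite /s -dotNr -(enormN w); exact: dot_le_enorm.
have w0 := enorm_ge0 w.
pose e := s / r; have eE : s = e * r by rewrite divfK // gt_eqF.
have -> : r^-1 * s = e by rewrite mulrC.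
have -> : r ^- 2 * s ^+ 2 = e ^+ 2.
  by rewrite eE exprMn mulrCA mulVf ?mulr1 // expf_neq0 // gt_eqF.
have e1 : e <= enorm w by rewrite -(ler_pM2r r0) -eE mulrC.
have e2 : - e <= enorm w by rewrite -(ler_pM2r r0) mulNr -eE mulrC.
have T0 : 0 <= q - e ^+ 2 by rewrite qE; nra.
set T := q - e ^+ 2 in T0 *.
have i0 : 0 < r^-1 by rewrite invr_gt0.
have iT : r^-1 * T * r = T by rewrite mulrC mulrA mulfV ?mul1r // gt_eqF.
have iT0 : 0 <= r^-1 * T by rewrite mulr_ge0 // ltW.
rewrite -(@ler_pXn2r _ 2) ?nnegrE ?enorm_ge0 //; last by lra.
rewrite sqr_enorm !(dotDl, dotDr) (dotC w p) -/s -/q r2 eE.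
have -> : q = T + e ^+ 2 by rewrite /T subrK.
move: (r^-1 * T) iT iT0 => k <- k0.
nra.
Qed.

End Cones.

(** * Comparison with cones *)

Section ConeComparison.
Variables (R : realType) (n : nat).
Implicit Types (v w x y z p xi : 'rV[R]_n) (A : set 'rV[R]_n) (M : 'M[R]_n).
Implicit Types (t a b c eta : R).
Implicit Types (h f u phi : 'rV[R]_n -> R) (Omega : set 'rV[R]_n).

Lemma sqr_enormD v w :
  enorm (v + w) ^+ 2 = enorm v ^+ 2 + 2 * dot v w + dot w w.
Proof. by rewrite !sqr_enorm !(dotDl, dotDr) (dotC w v); ring. Qed.

(** The touching quadratic has second derivative [- b] along its gradient, as
    long as the cone is increasing at [x] (so that the gradient is a positive
    multiple of [x - z]) or is a paraboloid (so that all second derivatives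
    are [- b]). *)
Lemma cone_touched_above c a b z x : 0 <= a ->
  a = 0 \/ 0 < enorm (x - z) /\ b * enorm (x - z) < a ->
  exists xi M, touches_above (cone c a b z) x xi M /\
    forall v t, v != 0 -> 0 <= t -> xi = t *: v ->
      2 * quad_form M v = - b * dot v v.
Proof.
move=> a0 Ha; set p := x - z in Ha *; set r := enorm p in Ha *.
have r0 : 0 <= r by exact: enorm_ge0.
pose M0 := r^-1 *: (1%:M - (r ^-2) *: (p^T *m p)).
exists ((a / r - b) *: p), (a *: M0 - (b / 2) *: 1%:M); split.
  have near0 : exists2 d, 0 < d & forall w, enorm w < d ->
      a * enorm (p + w) <= a * (r + dot (r^-1 *: p) w + quad_form M0 w).
    case: Ha => [->|[p0 _]]; first by exists 1 => // w _; rewrite !mul0r.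
    have pn0 : p != 0 by rewrite -enorm_gt0.
    have /nbhs_enormP[d d0 H] := enorm_touched_above pn0.
    by exists d => // w wd; apply: ler_wpM2l => //; apply: H; rewrite subr0.
  have [d d0 H] := near0; apply/nbhs_enormP; exists d => // y /H.
  rewrite /cone; set w := y - x; have -> : y - z = p + w.
    by rewrite /p /w [RHS]addrC addrA subrK.
  rewrite -/p -/r sqr_enormD -/r.
  rewrite quad_formDl quad_formNl !quad_formZl quad_form1 !dotZl.
  lra.
move=> v t v0 t0 e.
rewrite quad_formDl quad_formNl (quad_formZl a) (quad_formZl (b / 2)).
rewrite quad_form1.
suff : a * quad_form M0 v = 0 by lra.
case: Ha => [->|[p0 br]]; first by rewrite mul0r.
have k0 : 0 < a / r - b by rewrite subr_gt0 ltr_pdivlMr.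
have ps : p = (t / (a / r - b)) *: v.
  by rewrite mulrC -scalerA -e scalerA mulVf ?scale1r // gt_eqF.
rewrite quad_formZl quad_formDl quad_formNl quad_formZl quad_form1.
rewrite quad_form_rank1.
suff -> : r ^- 2 * dot p v ^+ 2 = dot v v by rewrite subrr !mulr0.
have r2 : r ^+ 2 != 0 by rewrite expf_neq0 // gt_eqF.
apply: (mulfI r2); rewrite mulrA mulfV // mul1r /r sqr_enorm ps.
rewrite !dotZl dotZr; ring.
Qed.

(** At a maximum point of [u - cone] over [A] with positive value, the quadratic
    touching the cone from above, shifted, also touches [u] from above, and its
    second derivative [- b] contradicts [h < b]. The set of points where [u]
    exceeds the cone is the only place where hypotheses are required, which
    lets the vertex and the boundary of [A] be excluded case by case. *)
Lemma cone_comparison Omega h u A c a b z :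
  subsolution Omega h u -> 0 <= a -> compact A -> {within A, continuous u} ->
  (forall y, A y -> cone c a b z y < u y ->
    [/\ Omega y, nbhs y A, h y < b &
      a = 0 \/ 0 < enorm (y - z) /\ b * enorm (y - z) < a]) ->
  forall y, A y -> u y <= cone c a b z y.
Proof.
move=> su a0 cA cu H y0 Ay0; rewrite leNgt; apply/negP => y0W.
have [y1 Ay1 max] : exists2 y, A y & forall x, A x ->
    u x - cone c a b z x <= u y - cone c a b z y.
  have [|||y /set_mem Ay My] := @EVT_max_rV R n (u - cone c a b z) A.
  - by exists y0.
  - exact: cA.
  - apply: within_continuousB => //; apply: continuous_subspaceT.
    exact: continuous_cone.
  by exists y => // x Ax; apply: My; rewrite inE.
have [Oy1 nA hb Ha] : [/\ Omega y1, nbhs y1 A, h y1 < b &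
    a = 0 \/ 0 < enorm (y1 - z) /\ b * enorm (y1 - z) < a].
  by apply: H => //; have := max _ Ay0; lra.
have [xi [M [tM HM]]] := cone_touched_above c a0 Ha.
have tu : touches_above u y1 xi M.
  rewrite /touches_above; near=> x.
  have Ax : A x by near: x.
  have : cone c a b z x <=
      cone c a b z y1 + dot xi (x - y1) + quad_form M (x - y1) by near: x.
  by have := max x Ax; lra.
have e0 : 0 < (b - h y1) / 2 by lra.
have [v [t [v0 t0 e]]] := su _ _ _ Oy1 tu _ e0.
rewrite (HM v t v0 t0 e); have : 0 < dot v v by rewrite dotvv_gt0.
by move/(mulr_gt0 e0); lra.
Unshelve. all: by end_near.
Qed.

Lemma compact_closed_eball x (r : R) : compact [set y | enorm (y - x) <= r].
Proof.
apply: bounded_closed_compact.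
  exists (r + `|x|); split=> [|M rM y /= yr]; first exact: num_real.
  apply: le_trans (ltW rM).
  rewrite -(subrK x y) (le_trans (ler_normD _ _)) // lerD2r.
  exact: le_trans (ler_norm_enorm _) yr.
rewrite (_ : [set _ | _] = (fun y => enorm (y - x)) @^-1` [set t | t <= r]) //.
apply: closed_comp; last exact: closed_le.
by move=> y _; exact: continuous_enorm.
Qed.

Lemma nbhs_eball x y (r : R) : enorm (y - x) < r ->
  nbhs y [set y | enorm (y - x) <= r].
Proof.
move=> yr; apply/nbhs_enormP; exists (r - enorm (y - x)); first by lra.
move=> w wr /=; have := ler_distD_enorm y w x; lra.
Qed.

(** Compare [u] with the cone of vertex [x] that equals [u x] at [x] and [M] at
    the distance [2 eps]; its value at the distance [eps] is
    [(u x + M + b eps^2) / 2]. If this cone stops increasing before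
    [2 eps], its peak is at least as high as [M], and the comparison is made
    on the ball that reaches up to the peak. *)
Lemma midpoint_le Omega h u x (eps M b : R) : 0 < eps ->
  subsolution Omega h u -> {within Omega, continuous u} ->
  (forall y, enorm (y - x) <= 2 * eps -> [/\ Omega y, h y < b & u y <= M]) ->
  forall y, enorm (y - x) <= eps -> 2 * u y <= u x + M + b * eps ^+ 2.
Proof.
move=> e0 su cu H y ye.
have xx : enorm (x - x) = 0 by rewrite subrr enorm0.
pose B r := [set y | enorm (y - x) <= r].
have BO r : r <= 2 * eps -> B r `<=` Omega.
  by move=> r2 w wr; have [] := H w (le_trans wr r2).
have cB r : r <= 2 * eps -> {within B r, continuous u}.
  by move=> r2; apply: continuous_subspaceW cu; exact: BO.
have [_ _ uxM] : [/\ Omega x, h x < b & u x <= M] by apply: H; rewrite xx; lra.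
pose del := M - u x.
(* Only for [b < 0] does this say something: [u] then grows at least like the
   paraboloid of second derivative [- b], which keeps the slope [a] below
   nonnegative. *)
have delb : 0 <= del + 2 * b * eps ^+ 2.
  rewrite leNgt; apply/negP => neg.
  pose k := - (del + 2 * b * eps ^+ 2) / 2.
  suff : u x <= cone (u x - k) 0 b x x.
    by rewrite /cone xx /k; lra.
  apply: (@cone_comparison Omega h u (B (2 * eps)) (u x - k) 0 b x) => //.
  - exact: compact_closed_eball.
  - exact: cB.
  - move=> w wB; have [Ow hw uw] := H w wB; rewrite /cone => cw.
    split=> //; last by left.
    apply: nbhs_eball; rewrite lt_neqAle wB andbT; apply/eqP => wE.
    by move: cw; rewrite wE /k /del; rewrite /del in neg; nra.
  - by rewrite /B /= xx; lra.
pose a := (del + 2 * b * eps ^+ 2) / (2 * eps).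
have aE : a * (2 * eps) = del + 2 * b * eps ^+ 2.
  by rewrite divfK // gt_eqF; lra.
have a0 : 0 <= a by rewrite divr_ge0 //; lra.
have del0 : 0 <= del by rewrite subr_ge0.
(* The cone is constant exactly when [a = b = 0]; then [M = u x]. *)
have [[b0 az]|nondeg] : (b = 0 /\ a = 0) \/ (b <= 0 -> 0 < a \/ b < 0).
  case: (ltrP b 0) => b0; first by right; right.
  case: (ltrP 0 a) => a1; first by right; left.
  have [->|bn0] := eqVneq b 0; first by left; split=> //; lra.
  by right=> b1; exfalso; move/eqP: bn0; apply; lra.
  have [_ _ uyM] : [/\ Omega y, h y < b & u y <= M] by apply: H; lra.
  move: aE; rewrite az b0 /del; lra.
have [r [r1 r2 rb rM]] : exists r, [/\ eps <= r, r <= 2 * eps,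
    forall s, 0 < s -> s < r -> b * s < a & del <= a * r - b / 2 * r ^+ 2].
  case: (lerP b 0) => b0.
    exists (2 * eps); split; [lra|exact: lexx|move=> s s0 _|lra].
    by case: (nondeg b0) => ?; nra.
  case: (lerP (2 * b * eps) a) => ab.
    by exists (2 * eps); split; [lra|exact: lexx|move=> s s0 s1; nra|lra].
  (* here the cone peaks at [a / b < 2 eps], with height [a^2 / (2 b)] *)
  have rE : a / b * b = a by rewrite divfK // gt_eqF.
  exists (a / b); set r := a / b in rE *; split.
  - by rewrite -(ler_pM2r b0) rE; nra.
  - by rewrite -(ler_pM2r b0) rE; lra.
  - by move=> s s0 s1; rewrite -rE mulrC ltr_pM2r.
  - rewrite -(ler_pM2r b0).
    suff : 2 * b * del <= a ^+ 2 by move: rE; set ra := r; nra.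
    have e2 : 0 < eps ^+ 2 by rewrite exprn_gt0.
    rewrite -(ler_pM2r e2).
    have : (a * (2 * eps)) ^+ 2 = (del + 2 * b * eps ^+ 2) ^+ 2 by rewrite aE.
    have := sqr_ge0 (del - 2 * b * eps ^+ 2); lra.
have uy : u y <= cone (u x) a b x y.
  apply: (@cone_comparison Omega h u (B r) (u x) a b x) => //.
  - exact: compact_closed_eball.
  - exact: cB.
  - move=> w wB; have [Ow hw uw] := H w (le_trans wB r2); rewrite /cone => cw.
    have wx : 0 < enorm (w - x).
      rewrite enorm_gt0 subr_eq0; apply/eqP => wE.
      by move: cw; rewrite wE xx; lra.
    have wr : enorm (w - x) < r.
      rewrite lt_neqAle wB andbT; apply/eqP => wE.
      by move: cw; rewrite wE; move: rM; rewrite /del; lra.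
    by split=> //; [exact: nbhs_eball|right; split=> //; exact: rb].
  - exact: le_trans ye r1.
have mono : a * enorm (y - x) - b / 2 * enorm (y - x) ^+ 2 <=
    a * eps - b / 2 * eps ^+ 2.
  have := enorm_ge0 (y - x); set s := enorm (y - x) in ye *.
  move: ye; rewrite le_eqVlt => /orP[/eqP ->|se] s0; first exact: lexx.
  have m0 : 0 < (s + eps) / 2 by lra.
  have mr : (s + eps) / 2 < r by lra.
  by have := rb _ m0 mr; nra.
by move: uy mono; rewrite /cone; move: aE; rewrite /del; lra.
Qed.

End ConeComparison.

(** * Comparison for ordered right-hand sides *)

Section StrictComparison.
Variables (R : realType) (n : nat).
Implicit Types (v w x y z p xi : 'rV[R]_n) (A : set 'rV[R]_n) (M : 'M[R]_n).
Implicit Types (t a b c eta : R).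
Implicit Types (h f u phi : 'rV[R]_n -> R) (Omega : set 'rV[R]_n).

Lemma compact_closure Omega : bounded_set Omega -> compact (closure Omega).
Proof.
move=> bO; apply: bounded_closed_compact; last exact: closed_closure.
have [M [Mr hM]] := bO; exists M; split=> // r Mr' x.
have cl : closed [set y : 'rV[R]_n | `|y| <= r].
  rewrite (_ : [set _ | _] = Num.norm @^-1` [set t | t <= r]) //.
  by apply: closed_comp => [y _|]; [exact: norm_continuous|exact: closed_le].
suff : closure Omega `<=` [set y | `|y| <= r] by exact.
by rewrite ((closure_id _).1 cl); apply: closureS => y; exact: hM.
Qed.

Lemma continuous_compact_bounded A u : compact A -> {within A, continuous u} ->
  exists2 C, 0 < C & forall x, A x -> `|u x| <= C.
Proof.
move=> cA cu; have [->|A0] := eqVneq A set0; first by exists 1.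
move/set0P: A0 => A0.
have [x _ Mx] := EVT_max_rV A0 cA cu; have [y _ My] := EVT_min_rV A0 cA cu.
exists (`|u x| + `|u y| + 1) => [|z Az]; first by rewrite ltr_wpDl.
have := Mx _ (mem_set Az); have := My _ (mem_set Az).
have := ler_norm (u x); have := ler_norm (- u y); rewrite normrN => h1 h2 h3 h4.
have := normr_ge0 (u x); have := normr_ge0 (u y).
by rewrite ler_norml; lra.
Qed.

Lemma closure_sub_boundary Omega x : open Omega ->
  closure Omega x -> ~ boundary Omega x -> Omega x.
Proof.
move=> oO cx nb; apply: contrapT => nx; apply: nb; split=> //.
by rewrite interior_id in oO; rewrite oO.
Qed.

Lemma boundary_not Omega x : open Omega -> boundary Omega x -> ~ Omega x.
Proof. by move=> oO [_]; rewrite ((interior_id _).1 oO). Qed.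

Lemma inv_succ_lt (r : R) : 0 < r ->
  exists N : nat, forall k : nat, (N <= k)%N -> k.+1%:R^-1 < r.
Proof.
move=> r0; have i0 : 0 <= r^-1 by rewrite invr_ge0 ltW.
exists (Num.bound r^-1) => k Nk; rewrite invf_plt ?posrE //.
apply: lt_le_trans (archi_boundP i0) _; rewrite ler_nat.
exact: leq_trans Nk (leqnSn _).
Qed.

(** The parameter [eps] runs through [1 / (k + 1)]. A cluster point [xs] of the
    almost maximizing pairs is interior, because [u - v] is positive there;
    continuity of [h1] at the single point [xs] then separates [h1] from [h2]
    on the balls around the midpoints, for a suitable [k]. *)
Lemma strict_comparison Omega h1 h2 u (v : 'rV[R]_n -> R) (gam : R) :
  open Omega -> bounded_set Omega ->
  {within Omega, continuous h1} -> 0 < gam ->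
  (forall x, Omega x -> h1 x + gam <= h2 x) ->
  subsolution Omega h1 u -> subsolution Omega (- h2) (- v) ->
  {within closure Omega, continuous u} ->
  {within closure Omega, continuous v} ->
  (forall x, boundary Omega x -> u x <= v x) ->
  forall x, closure Omega x -> u x <= v x.
Proof.
move=> oO bO ch gam0 hgam su sv cu cv uvb x0 Kx0.
rewrite leNgt; apply/negP => uv0; pose m := u x0 - v x0.
have m0 : 0 < m by rewrite subr_gt0.
have cK := compact_closure bO; set K := closure Omega in cu cv cK Kx0 *.
have [Cu Cu0 hCu] := continuous_compact_bounded cK cu.
have [Cv Cv0 hCv] := continuous_compact_bounded cK cv.
have pairs (e tau : R) : 0 < e -> 0 < tau -> exists y z P,
    [/\ K y, K z, enorm (y - z) <= 2 * e, P - tau < u y - v z & m <= P /\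
        forall y' z', K y' -> K z' -> enorm (y' - z') <= 2 * e ->
          u y' - v z' <= P].
  move=> e0 tau0.
  pose S := [set s | exists y z, [/\ K y, K z, enorm (y - z) <= 2 * e &
     s = u y - v z]].
  have Sm : S m.
    by exists x0, x0; split=> //; rewrite subrr enorm0; lra.
  have hs : has_sup S.
    split; first by exists m.
    exists (Cu + Cv) => _ [y [z [Ky Kz _ ->]]].
    by have := hCu _ Ky; have := hCv _ Kz; rewrite !ler_norml; lra.
  have [_ [y [z [Ky Kz yz ->]]] hP] := sup_adherent tau0 hs.
  exists y, z, (sup S); split=> //; split; first exact: sup_upper_bound.
  by move=> y' z' Ky' Kz' yz'; apply: sup_upper_bound => //; exists y', z'.
pose e k : R := k.+1%:R^-1.
have e0 k : 0 < e k by rewrite invr_gt0.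
(* [m / 4] keeps [u - v] positive in the limit; the error [2 tau] must stay
   below the gain [(gam / 2) eps^2] of the finite difference inequalities *)
pose tau k := Num.min (m / 4) (gam / 8 * e k ^+ 2).
have tau0 k : 0 < tau k.
  by rewrite lt_min; apply/andP; split; rewrite ?mulr_gt0 ?exprn_gt0 //; lra.
have [Y HY] := choice (fun k => pairs (e k) (tau k) (e0 k) (tau0 k)).
have [Z HZ] := choice HY; have [P HP] := choice HZ.
move: HP => {HY HZ pairs} HP.
have [xs [Kxs cl]] : K `&` cluster (Y @ \oo) !=set0.
  by apply: cK; exists 0 => // k _ /=; have [] := HP k.
have freq (r : R) : 0 < r -> exists k, [/\ enorm (Y k - xs) < r & e k < r].
  move=> r0; have [N HN] := inv_succ_lt r0.
  have [_ [[k Nk <-] Yk]] : ([set p | exists2 k, (N <= k)%N & Y k = p] `&`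
      [set p | enorm (p - xs) < r]) !=set0.
    apply: cl; last by apply/nbhs_enormP; exists r.
    by exists N => //= k /= Nk; exists k.
  by exists k; split=> //; exact: HN.
have Oxs : Omega xs.
  apply: closure_sub_boundary => // bxs.
  have m8 : 0 < m / 8 by lra.
  have [du du0 hu] := (continuous_withinP _ _).1 cu _ Kxs _ m8.
  have [dv dv0 hv] := (continuous_withinP _ _).1 cv _ Kxs _ m8.
  have d0 : 0 < Num.min du (dv / 3) by rewrite lt_min du0 divr_gt0.
  have [k []] := freq _ d0; rewrite !lt_min => /andP[y1 y2] /andP[_ e2].
  have [Ky Kz yz hP [mP _]] := HP k.
  have := hu _ Ky y1.
  have /(hv _ Kz) : enorm (Z k - xs) < dv.
    have := ler_distD_enorm (Y k) (Z k) xs; rewrite (enormBC (Z k) (Y k)).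
    lra.
  have : tau k <= m / 4 by rewrite ge_min lexx.
  by have := uvb _ bxs; rewrite !ltr_norml; lra.
have g4 : 0 < gam / 4 by lra.
have [dh dh0 hh] := (continuous_withinP _ _).1 ch _ Oxs _ g4.
have [dO dO0 hO] := (nbhs_enormP _ _).1 (open_nbhs_nbhs (conj oO Oxs)).
have d0 : 0 < Num.min dh dO / 8 by rewrite divr_gt0 // lt_min dh0.
have [k [yk ek]] := freq _ d0.
have [Ky Kz yz hP [mP maxP]] := HP k.
pose x := 2^-1 *: (Y k + Z k).
have yx : enorm (Y k - x) <= e k.
  have -> : Y k - x = 2^-1 *: (Y k - Z k).
    by apply/rowP => i; rewrite !mxE; field.
  by rewrite enormZ ger0_norm //; lra.
have zx : enorm (Z k - x) <= e k.
  have -> : Z k - x = 2^-1 *: (Z k - Y k).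
    by apply/rowP => i; rewrite !mxE; field.
  by rewrite enormZ ger0_norm // enormBC; lra.
have near w : enorm (w - x) <= 2 * e k ->
    [/\ Omega w, K w & `|h1 w - h1 xs| < gam / 4].
  move=> wx; have wxs : enorm (w - xs) < Num.min dh dO.
    have := ler_distD_enorm x w xs; have := ler_distD_enorm (Y k) x xs.
    by rewrite (enormBC x (Y k)); have := e0 k; lra.
  move: wxs; rewrite lt_min => /andP[w1 w2]; have Ow := hO _ w2.
  by split=> //; [exact: subset_closure|exact: hh].
have [_ Kx _] : [/\ Omega x, K x & `|h1 x - h1 xs| < gam / 4].
  by apply: near; rewrite subrr enorm0; have := e0 k; lra.
have cOu : {within Omega, continuous u}.
  by apply: continuous_subspaceW cu; exact: subset_closure.
have cOv : {within Omega, continuous (- v)}.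
  move=> p; apply: cvgN; apply: continuous_subspaceW cv p.
  exact: subset_closure.
have Hu : 2 * u (Y k) <= u x + (P k + v x) + (h1 xs + gam / 4) * e k ^+ 2.
  apply: (midpoint_le (e0 k) su cOu) => // w wx.
  have [Ow Kw] := near w wx; rewrite ltr_norml => hw; split=> //; first by lra.
  by have := maxP w x Kw Kx wx; lra.
have Hv : 2 * (- v) (Z k) <=
    (- v) x + (P k - u x) + - (h1 xs + 3 * gam / 4) * e k ^+ 2.
  apply: (midpoint_le (e0 k) sv cOv) => // w wx.
  have [Ow Kw] := near w wx; rewrite ltr_norml => hw; split=> //.
    by have := hgam _ Ow; rewrite fctE; lra.
  rewrite fctE; have := maxP x w Kx Kw; rewrite enormBC => /(_ wx); lra.
have : tau k <= gam / 8 * e k ^+ 2 by rewrite ge_min lexx orbT.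
have : 0 < gam * e k ^+ 2 by rewrite mulr_gt0 ?exprn_gt0.
by move: Hu Hv hP; rewrite !fctE; lra.
Qed.

End StrictComparison.

(** * Strict inequalities near a point, and maxima of subsolutions *)

Section Jets.
Variables (R : realType) (n : nat).
Implicit Types (v w x y z p b xi : 'rV[R]_n) (A : set 'rV[R]_n) (M N : 'M[R]_n).
Implicit Types (t a c eta : R).
Implicit Types (h f u phi : 'rV[R]_n -> R) (Omega : set 'rV[R]_n).

Lemma quad_form_le M : exists2 C, 0 <= C &
  forall v, quad_form M v <= C * enorm v ^+ 2.
Proof.
have [C hC] := quad_form_le_unit M.
exists (Num.max C 0) => [|v]; first by rewrite le_max lexx orbT.
have [->|v0] := eqVneq v 0; first by rewrite quad_form0 enorm0 expr0n mulr0.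
have ev : 0 < enorm v by rewrite enorm_gt0.
have vE : v = enorm v *: ((enorm v)^-1 *: v).
  by rewrite scalerA mulfV ?scale1r // gt_eqF.
rewrite {1}vE quad_formZr mulrC ler_pM2r ?exprn_gt0 //.
apply: le_trans (hC _ _) _; last by rewrite le_max lexx.
by rewrite enormZ ger0_norm ?invr_ge0 ?enorm_ge0 // mulVf // gt_eqF.
Qed.

Lemma quad_form_norm_le M : exists2 C, 0 <= C &
  forall v, `|quad_form M v| <= C * enorm v ^+ 2.
Proof.
have [C C0 hC] := quad_form_le M; have [D D0 hD] := quad_form_le (- M).
exists (C + D) => [|v]; first exact: addr_ge0.
have := hC v; have := hD v; rewrite quad_formNl.
have := sqr_ge0 (enorm v); set e := enorm v ^+ 2 => e0 h1 h2.
by rewrite ler_norml; nra.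
Qed.

Lemma small_quadratic b M (e : R) : 0 < e -> exists2 d, 0 < d &
  forall w, enorm w < d -> `|dot b w + quad_form M w| < e.
Proof.
move=> e0; have [C C0 hC] := quad_form_norm_le M.
have k0 : 0 < enorm b + C + 1 by rewrite ltr_wpDl // addr_ge0 // enorm_ge0.
exists (Num.min 1 (e / (enorm b + C + 1))).
  by rewrite lt_min ltr01 divr_gt0.
move=> w; rewrite lt_min ltr_pdivlMr // => /andP[w1 we].
have w0 := enorm_ge0 w.
apply: le_lt_trans (ler_normD _ _) _.
have d1 : `|dot b w| <= enorm b * enorm w.
  rewrite ler_norml dot_le_enorm andbT lerNl -dotNr -(enormN w).
  exact: dot_le_enorm.
have := hC w; have : enorm w ^+ 2 <= enorm w by nra.
have := enorm_ge0 b; nra.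
Qed.

Lemma quad_form_mulmx M N v :
  quad_form M (v *m N) = quad_form (N *m M *m N^T) v.
Proof. by rewrite !quad_formE trmx_mul !mulmxA. Qed.

(** Failure of the subsolution inequality for a quadratic persists nearby. For
    [xi = 0] the inequality at [x0] holds in all directions; for [xi != 0] it
    is an open condition on the gradient [xi + (y - x0) (M + M^T)] itself,
    since both sides are homogeneous in [v]. *)
Lemma aligned_strict_open Omega h x0 xi M eta :
  open Omega -> {within Omega, continuous h} -> Omega x0 -> 0 < eta ->
  (forall v t, v != 0 -> 0 <= t -> xi = t *: v ->
     2 * quad_form M v + (h x0 + eta) * dot v v < 0) ->
  exists r, [/\ 0 < r, forall y, enorm (y - x0) < r -> Omega y &
    forall y, enorm (y - x0) < r ->
    forall v t, v != 0 -> 0 <= t -> xi + (y - x0) *m (M + M^T) = t *: v ->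
      2 * quad_form M v + (h y + eta / 2) * dot v v < 0].
Proof.
move=> oO ch Ox0 eta0 N.
have [dO dO0 hO] := (nbhs_enormP _ _).1 (open_nbhs_nbhs (conj oO Ox0)).
have eta2 : 0 < eta / 2 by lra.
have [dh dh0 hh] := (continuous_withinP _ _).1 ch _ Ox0 _ eta2.
suff [d d0 hd] : exists2 d, 0 < d & forall y, enorm (y - x0) < d ->
    forall v t, v != 0 -> 0 <= t -> xi + (y - x0) *m (M + M^T) = t *: v ->
      2 * quad_form M v + (h x0 + eta) * dot v v < 0.
  exists (Num.min d (Num.min dO dh)); split=> [|y|y].
  - by rewrite !lt_min d0 dO0 dh0.
  - by rewrite !lt_min => /and3P[_ yO _]; exact: hO.
  - rewrite !lt_min => /and3P[yd yO yh] v t v0 t0 e.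
    have := hd _ yd v t v0 t0 e; have := hh _ (hO _ yO) yh.
    have : 0 < dot v v by rewrite dotvv_gt0.
    rewrite ltr_norml => vv /andP[_ h1].
    have : (h y + eta / 2) * dot v v <= (h x0 + eta) * dot v v.
      by rewrite ler_pM2r //; lra.
    lra.
have [xi0|xi0] := eqVneq xi 0.
  exists 1 => // y _ v t v0 t0 _; apply: (N v 0) => //.
  by rewrite xi0 scale0r.
(* the form whose sign on the gradient at [y] is the inequality *)
pose H := (M + M) + (h x0 + eta) *: 1%:M.
have HE v : quad_form H v = 2 * quad_form M v + (h x0 + eta) * dot v v.
  by rewrite !quad_formDl quad_formZl quad_form1; lra.
have G0 : quad_form H xi < 0.
  by rewrite HE; apply: (N xi 1); rewrite ?scale1r.
pose S := M + M^T.
have NG0 : 0 < - quad_form H xi by rewrite oppr_gt0.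
have [d d0 hd] :=
  small_quadratic ((xi *m (H + H^T)) *m S^T) (S *m H *m S^T) NG0.
exists d => // y yd v t v0 t0 e.
have : quad_form H (t *: v) < 0.
  rewrite -e quad_formDr quad_form_mulmx.
  have := hd _ yd; rewrite ltr_norml -/S => /andP[_].
  by rewrite (dot_mulmx _ (y - x0)) trmxK dotC; lra.
rewrite quad_formZr HE => neg.
by rewrite ltNge; apply/negP => pos; have := mulr_ge0 (sqr_ge0 t) pos; lra.
Qed.

Lemma continuous_quad_poly a b M : continuous (quad_poly a b M).
Proof.
move=> x; apply/(@cvgrPdist_lt _ _ _ _ (nbhs_filter x)) => e e0.
have [d d0 hd] := small_quadratic (b + x *m (M + M^T)) M e0.
apply/nbhs_enormP; exists d => // y /hd.
have := quad_poly_taylor a b M x (y - x); rewrite (addrC x) subrK => ->.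
by rewrite distrC -[X in `|X - _|]addrA [_ + (_ + _)]addrC addrK.
Qed.

Lemma within_continuous_max A u (v : 'rV[R]_n -> R) :
  {within A, continuous u} -> {within A, continuous v} ->
  {within A, continuous (fun x => Num.max (u x) (v x))}.
Proof.
move=> /continuous_withinP cu /continuous_withinP cv.
apply/continuous_withinP => x Ax e e0.
have [d d0 hd] := cu x Ax e e0; have [d' d0' hd'] := cv x Ax e e0.
exists (Num.min d d') => [|y Ay]; first by rewrite lt_min d0.
rewrite lt_min => /andP[yd yd']; have := hd y Ay yd; have := hd' y Ay yd'.
rewrite !ltr_norml.
by case: (lerP (u x) (v x)) => ?; case: (lerP (u y) (v y)) => ?; lra.
Qed.

Lemma touches_above_le u (v : 'rV[R]_n -> R) x xi M :
  (\forall y \near x, u y <= v y) -> u x = v x ->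
  touches_above v x xi M -> touches_above u x xi M.
Proof.
move=> uv e tv; rewrite /touches_above; near=> y; rewrite e.
have : u y <= v y by near: y.
have : v y <= v x + dot xi (y - x) + quad_form M (y - x) by near: y.
lra.
Unshelve. all: by end_near.
Qed.

Lemma subsolution_max Omega h u (v : 'rV[R]_n -> R) :
  subsolution Omega h u -> subsolution Omega h v ->
  subsolution Omega h (fun x => Num.max (u x) (v x)).
Proof.
move=> su sv x xi M Ox tw; have [uv|vu] := lerP (u x) (v x).
  apply: sv => //; apply: touches_above_le tw; last by rewrite max_r.
  by apply/nbhs_enormP; exists 1 => // y _; rewrite le_max lexx orbT.
apply: su => //; apply: touches_above_le tw; last by rewrite max_l // ltW.
by apply/nbhs_enormP; exists 1 => // y _; rewrite le_max lexx.
Qed.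

Lemma subsolution_opp_cone Omega h c a (b : R) z : (0 < n)%N -> 0 <= a ->
  (forall x, Omega x -> 0 <= b + h x) ->
  (forall x, Omega x -> a = 0 \/ 0 < enorm (x - z) /\ b * enorm (x - z) < a) ->
  subsolution Omega h (- cone c a b z).
Proof.
move=> n0 a0 hb Ha x xi1 M1 Ox.
have [xi [M [tM HM]]] := cone_touched_above c a0 (Ha x Ox).
apply: (@touched_below_subsolution_at _ _ _ _ (- xi) (- M)) => //.
  by rewrite !opprK.
move=> v t v0 t0 e; have := HM (- v) t; rewrite oppr_eq0 => /(_ v0 t0).
rewrite scalerN -e opprK quad_formNr dotNl dotNr opprK => /(_ erefl) QM.
rewrite quad_formNl; have := mulr_ge0 (hb x Ox) (dotvv_ge0 v); lra.
Qed.

End Jets.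

(** * Perron's method *)

Section Perron.
Variables (R : realType) (n : nat).
Implicit Types (v w x y z p b xi : 'rV[R]_n) (A : set 'rV[R]_n) (M N : 'M[R]_n).
Implicit Types (t a c eta : R).
Variables (Omega : set 'rV[R]_n) (h g : 'rV[R]_n -> R) (K C Gam : R).
Implicit Types (u phi : 'rV[R]_n -> R).
Hypotheses (n_gt0 : (0 < n)%N) (oO : open Omega) (bO : bounded_set Omega).
Hypotheses (ch : {within Omega, continuous h}).
Hypotheses (cg : {within boundary Omega, continuous g}).
Hypotheses (K0 : 0 < K) (hK : forall x, Omega x -> `|h x| < K).
Hypotheses (C0 : 0 < C) (hC : forall x, closure Omega x -> enorm x <= C).
Hypotheses (Gam0 : 0 < Gam).
Hypotheses (hGam : forall x, boundary Omega x -> `|g x| <= Gam).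

Let B : R := Gam + K / 2 * C ^+ 2.

(** The uniform lower bound is what makes the Lipschitz estimate uniform over
    the family; [B] is chosen so that the paraboloid of second derivative [K]
    bounded above by [- Gam] on the closure belongs to it. *)
Definition perron_family u : Prop :=
  [/\ {within closure Omega, continuous u}, subsolution Omega h u,
      forall x, boundary Omega x -> u x <= g x &
      forall x, closure Omega x -> - B <= u x].

Definition perron x : R := sup [set u x | u in perron_family].

Let cl_sub x : Omega x -> closure Omega x. Proof. exact: subset_closure. Qed.

Let nbhs_cl x : Omega x -> nbhs x (closure Omega).
Proof.
by move=> Ox; apply: filterS (open_nbhs_nbhs (conj oO Ox)); exact: cl_sub.
Qed.

Let constants : [/\ 0 < K, 0 < C, 0 < Gam & Gam <= B].
Proof.
split=> //; rewrite /B lerDl; apply: mulr_ge0; last exact: sqr_ge0.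
by rewrite divr_ge0 // ltW.
Qed.

Lemma within_continuous_cone A c a (b : R) z :
  {within A, continuous (cone c a b z)}.
Proof. by apply: continuous_subspaceT; exact: continuous_cone. Qed.

Lemma within_continuous_opp_cone A c a (b : R) z :
  {within A, continuous (- cone c a b z)}.
Proof. by move=> x; apply: cvgN; exact: within_continuous_cone. Qed.

Lemma perron_family_paraboloid : perron_family (- cone B 0 K 0).
Proof.
have [Kp Cp Gp Bp] := constants.
have sq x : closure Omega x -> enorm (x - 0) ^+ 2 <= C ^+ 2.
  by move=> /hC xC; rewrite subr0 ler_pXn2r ?nnegrE ?enorm_ge0 // ltW.
have k2 : 0 <= K / 2 by lra.
split.
- exact: within_continuous_opp_cone.
- apply: subsolution_opp_cone => // x Ox; last by left.
  by have := hK Ox; rewrite ltr_norml; lra.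
- move=> x bx; have := hGam bx; rewrite ler_norml fctE /cone /B.
  by have := ler_wpM2l k2 (sq x bx.1); lra.
- move=> x cx; rewrite fctE /cone.
  by have := mulr_ge0 k2 (sqr_ge0 (enorm (x - 0))); lra.
Qed.

Lemma perron_family_le u : perron_family u ->
  forall x, closure Omega x -> u x <= B.
Proof.
have [Kp Cp Gp Bp] := constants.
move=> [cu su ug _] x cx.
have k2 : 0 <= K / 2 by lra.
suff : u x <= cone B 0 K 0 x.
  by rewrite /cone; have := mulr_ge0 k2 (sqr_ge0 (enorm (x - 0))); lra.
apply: (cone_comparison su (lexx 0) (compact_closure bO)) => // y cy yu.
have Oy : Omega y.
  apply: closure_sub_boundary => // by_; have := ug _ by_; have := hGam by_.
  have : enorm (y - 0) ^+ 2 <= C ^+ 2.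
    by rewrite subr0 ler_pXn2r ?nnegrE ?enorm_ge0 ?hC // ltW.
  move/(ler_wpM2l k2) => sq; move: yu; rewrite ler_norml /cone /B; lra.
split=> //; [exact: nbhs_cl| |by left].
by have := hK Oy; rewrite ltr_norml; lra.
Qed.

Lemma perron_has_sup x : closure Omega x ->
  has_sup [set u x | u in perron_family].
Proof.
have [Kp Cp Gp Bp] := constants.
move=> cx; split.
  exists ((- cone B 0 K 0) x), (- cone B 0 K 0) => //.
  exact: perron_family_paraboloid.
by exists B => _ [u Fu <-]; exact: perron_family_le.
Qed.

Lemma perron_ge u x : closure Omega x -> perron_family u -> u x <= perron x.
Proof.
by move=> cx Fu; apply: sup_upper_bound; [exact: perron_has_sup|exists u].
Qed.

Lemma perron_le x (c : R) : closure Omega x ->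
  (forall u, perron_family u -> u x <= c) -> perron x <= c.
Proof.
move=> cx H; apply: ge_sup; first by have [] := perron_has_sup cx.
by move=> _ [u Fu <-]; exact: H.
Qed.

Lemma perron_adherent x (e : R) : closure Omega x -> 0 < e ->
  exists2 u, perron_family u & perron x - e < u x.
Proof.
move=> cx e0; have [_ [u Fu <-] ue] := sup_adherent e0 (perron_has_sup cx).
by exists u.
Qed.

(** Each member of the family lies below the cone with vertex [x] whose slope
    is large enough to climb from [- B] to [B] over the distance [r]. *)
Lemma perron_lipschitz x (r : R) : 0 < r ->
  (forall y, enorm (y - x) <= r -> Omega y) ->
  forall y, enorm (y - x) <= r ->
    perron y <= perron x + (2 * B / r + K * r) * enorm (y - x).
Proof.
have [Kp Cp Gp Bp] := constants.
move=> r0 ballO y yr; have Oy := ballO y yr.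
have Ox : Omega x by apply: ballO; rewrite subrr enorm0 ltW.
set L := 2 * B / r + K * r.
have Lr : L * r = 2 * B + K * r ^+ 2.
  by rewrite /L mulrDl divfK ?gt_eqF //; ring.
have K2 : 0 <= K / 2 by lra.
apply: perron_le => [|u Fu]; first exact: cl_sub.
have B0 : 0 < B by lra.
have L0 : 0 < L by rewrite addr_gt0 ?mulr_gt0 ?invr_gt0 //.
have [cu su ug uB] := Fu.
have : u y <= cone (u x) L K x y.
  apply: (@cone_comparison _ _ Omega h u [set y | enorm (y - x) <= r]
    (u x) L K x) => //.
  - exact: ltW.
  - exact: compact_closed_eball.
  - by apply: continuous_subspaceW cu => w /ballO; exact: cl_sub.
  - move=> w wr wu; have Ow := ballO w wr.
    have wr' : enorm (w - x) < r.
      rewrite lt_neqAle wr andbT; apply/eqP => wE; move: wu.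
      have := perron_family_le Fu (cl_sub Ow); have := uB _ (cl_sub Ox).
      have := mulr_ge0 K2 (sqr_ge0 r).
      by rewrite /cone wE; lra.
    split=> //; [exact: nbhs_eball|by have := hK Ow; rewrite ltr_norml; lra|].
    right; split.
      rewrite enorm_gt0 subr_eq0; apply/eqP => wx; move: wu.
      by rewrite /cone wx subrr enorm0; lra.
    apply: (@lt_trans _ _ (K * r)); first by rewrite ltr_pM2l.
    by rewrite /L ltrDr; apply: divr_gt0 => //; lra.
have := perron_ge (cl_sub Ox) Fu; rewrite /cone.
have := mulr_ge0 K2 (sqr_ge0 (enorm (y - x))); lra.
Qed.

Lemma perron_continuous_interior x : Omega x -> forall e, 0 < e ->
  exists2 d, 0 < d & forall y, enorm (y - x) < d -> `|perron y - perron x| < e.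
Proof.
have [Kp Cp Gp Bp] := constants.
move=> Ox e e0.
have [d d0 hd] := (nbhs_enormP _ _).1 (open_nbhs_nbhs (conj oO Ox)).
pose r := d / 3; have r0 : 0 < r by rewrite divr_gt0.
pose L := 2 * B / r + K * r.
have B0 : 0 < B by lra.
have L0 : 0 < L by rewrite addr_gt0 ?mulr_gt0 ?invr_gt0 //.
exists (Num.min r (e / L)); first by rewrite lt_min r0 divr_gt0.
move=> y; rewrite lt_min (ltr_pdivlMr _ _ L0) => /andP[yr ye].
have h1 : perron y <= perron x + L * enorm (y - x).
  apply: (perron_lipschitz r0 _ (ltW yr)) => w wr; apply: hd.
  by move: wr; rewrite /r; lra.
have h2 : perron x <= perron y + L * enorm (x - y).
  have xr : enorm (x - y) <= r by rewrite enormBC ltW.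
  apply: (perron_lipschitz r0 _ xr) => w wr; apply: hd.
  have := ler_distD_enorm y w x.
  by rewrite /r in wr yr; lra.
by move: h1 h2; rewrite (enormBC x y) ltr_norml; lra.
Qed.

(** Upper and lower barriers: cones with vertex [x0], which lies outside the
    domain, so the vertex is never a touching point. *)
Lemma perron_boundary x0 (e : R) : boundary Omega x0 -> 0 < e ->
  exists2 a, 0 <= a & forall y, closure Omega y ->
    `|perron y - g x0| <= e + a * enorm (y - x0).
Proof.
have [Kp Cp Gp Bp] := constants.
move=> bx0 e0; have nOx0 := boundary_not oO bx0.
have [d d0 hd] := (continuous_withinP _ _).1 cg _ bx0 _ e0.
(* [2 C] bounds the diameter, so the cone increases on the closure; beyond the
   distance [d] it rises by [2 Gam], which bounds the oscillation of [g] *)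
pose a := 2 * K * C + 2 * Gam / d.
have ad : 0 < 2 * Gam / d by rewrite !mulr_gt0 ?invr_gt0.
have KC : 0 < K * C by rewrite mulr_gt0.
have a0 : 0 <= a by rewrite /a; lra.
have K2 : 0 <= K / 2 by lra.
have diam y : closure Omega y -> enorm (y - x0) <= 2 * C.
  move=> /hC yC; apply: le_trans (ler_enormD _ _) _; rewrite enormN.
  by have := hC bx0.1; lra.
have grow y : closure Omega y ->
    (K * C + 2 * Gam / d) * enorm (y - x0) <=
    a * enorm (y - x0) - K / 2 * enorm (y - x0) ^+ 2.
  move=> /diam yC; have y0 := enorm_ge0 (y - x0).
  have : K * enorm (y - x0) <= 2 * (K * C) by nra.
  by move/(ler_wpM2r y0); rewrite /a; lra.
have gbar y : boundary Omega y -> `|g y - g x0| <=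
    e + (a * enorm (y - x0) - K / 2 * enorm (y - x0) ^+ 2).
  move=> b_y; apply: le_trans (lerD (lexx _) (grow y b_y.1)).
  have y0 := enorm_ge0 (y - x0).
  have [yd|dy] := ltP (enorm (y - x0)) d.
    have := hd _ b_y yd; have : 0 <= (K * C + 2 * Gam / d) * enorm (y - x0).
      by rewrite mulr_ge0 //; lra.
    by lra.
  have : (2 * Gam / d) * d <= (2 * Gam / d) * enorm (y - x0).
    by rewrite ler_pM2l.
  rewrite divfK ?gt_eqF // => h1.
  have h2 : 0 <= K * C * enorm (y - x0) by rewrite mulr_ge0 // ltW.
  apply: le_trans (ler_normB _ _) _.
  by have := hGam b_y; have := hGam bx0; lra.
have away x : Omega x -> 0 < enorm (x - x0) /\ K * enorm (x - x0) < a.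
  move=> Ox; split.
    by rewrite enorm_gt0 subr_eq0; apply/eqP => xx; apply: nOx0; rewrite -xx.
  have : K * enorm (x - x0) <= K * (2 * C).
    by rewrite ler_pM2l //; apply: diam; exact: cl_sub.
  by rewrite /a; lra.
exists a => // y cy; rewrite ler_norml; apply/andP; split.
  pose low x := Num.max ((- cone B 0 K 0) x) ((- cone (- g x0 + e) a K x0) x).
  have [c1 s1 g1 b1] := perron_family_paraboloid.
  have Fl : perron_family low.
    split.
    - by apply: (within_continuous_max c1); exact: within_continuous_opp_cone.
    - apply: subsolution_max s1 _; apply: subsolution_opp_cone => // x Ox.
        by have := hK Ox; rewrite ltr_norml; lra.
      by right; exact: away.
    - move=> x bx; rewrite ge_max g1 //= fctE /cone.
      by have := gbar _ bx; rewrite ler_norml; lra.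
    - by move=> x cx; rewrite le_max b1.
  have := perron_ge cy Fl.
  have : (- cone (- g x0 + e) a K x0) y <= low y by rewrite le_max lexx orbT.
  rewrite fctE /cone; have := mulr_ge0 K2 (sqr_ge0 (enorm (y - x0))); lra.
suff : perron y <= cone (g x0 + e) a K x0 y.
  rewrite /cone; have := mulr_ge0 K2 (sqr_ge0 (enorm (y - x0))); lra.
apply: perron_le => // u Fu; have [cu su ug _] := Fu.
apply: (cone_comparison su a0 (compact_closure bO)) => // w cw wu.
have Ow : Omega w.
  apply: closure_sub_boundary => // bw; have := ug _ bw; have := gbar _ bw.
  by move: wu; rewrite ler_norml /cone; lra.
split=> //; [exact: nbhs_cl| |by right; exact: away].
by have := hK Ow; rewrite ltr_norml; lra.
Qed.

Lemma perron_eq_boundary x : boundary Omega x -> perron x = g x.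
Proof.
move=> bx; apply/eqP; rewrite -subr_eq0 -normr_le0.
apply/ler_addgt0Pr => e e0; rewrite add0r.
have [a _ /(_ x bx.1)] := perron_boundary bx e0.
by rewrite subrr enorm0 mulr0 addr0.
Qed.

Lemma perron_continuous : {within closure Omega, continuous perron}.
Proof.
have [Kp Cp Gp Bp] := constants.
apply/continuous_withinP => x cx e e0.
have [Ox|nOx] := pselect (Omega x).
  have [d d0 hd] := perron_continuous_interior Ox e0.
  by exists d => // y _; exact: hd.
have bx : boundary Omega x by split=> //; rewrite ((interior_id _).1 oO).
have e2 : 0 < e / 2 by lra.
have [a a0 ha] := perron_boundary bx e2.
exists (e / 2 / (a + 1)); first by rewrite divr_gt0 // ltr_wpDl.
move=> y cy; rewrite ltr_pdivlMr ?ltr_wpDl // => yd.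
have := ha y cy; rewrite (perron_eq_boundary bx) => /le_lt_trans; apply.
have := enorm_ge0 (y - x); lra.
Qed.

(** If the inequality failed for a quadratic touching the supremum at [x0], it
    would fail strictly for nearby points. The quadratic made strict, a family
    member almost equal to the supremum at [x0] has its difference with it
    maximal at a nearby interior point, where that member would violate the
    inequality. *)
Lemma perron_subsolution : subsolution Omega h perron.
Proof.
move=> x0 xi M Ox0 tU eta eta0; apply: contrapT => noV.
have N v t : v != 0 -> 0 <= t -> xi = t *: v ->
    2 * quad_form M v + (h x0 + eta) * dot v v < 0.
  move=> v0 t0 e; rewrite ltNge; apply/negP => pos; apply: noV.
  by exists v, t.
pose th := eta / 4; have th0 : 0 < th by rewrite divr_gt0.
have eta2 : 0 < eta / 2 by rewrite divr_gt0.
pose M' := M + th *: 1%:M.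
have QM' w : quad_form M' w = quad_form M w + th * dot w w.
  by rewrite quad_formDl quad_formZl quad_form1.
have [r1 [r10 r1O open1]] : exists r, [/\ 0 < r,
    forall y, enorm (y - x0) < r -> Omega y &
    forall y, enorm (y - x0) < r -> forall v t, v != 0 -> 0 <= t ->
      xi + (y - x0) *m (M' + M'^T) = t *: v ->
      2 * quad_form M' v + (h y + eta / 2 / 2) * dot v v < 0].
  apply: (aligned_strict_open oO ch Ox0 eta2) => v t v0 t0 e.
  by have := N v t v0 t0 e; rewrite QM' /th; lra.
have [r2 r20 hr2] := (nbhs_enormP _ _).1 tU.
pose r := Num.min r1 r2 / 2.
have r12 : 0 < Num.min r1 r2 by rewrite lt_min r10.
have r0 : 0 < r by rewrite divr_gt0.
have ball y : enorm (y - x0) <= r -> enorm (y - x0) < r1 /\ enorm (y - x0) < r2.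
  move=> yr; have : enorm (y - x0) < Num.min r1 r2 by move: yr; rewrite /r; lra.
  by rewrite lt_min => /andP.
have [a [b [bE qE]]] := quad_poly_center (perron x0) xi M' x0.
have gradE y : b + y *m (M' + M'^T) = xi + (y - x0) *m (M' + M'^T).
  have add_shift (p q s : 'rV[R]_n) : p + q = p + s + (q - s).
    by rewrite -addrA (addrC s) subrK.
  by rewrite mulmxBl -bE; exact: add_shift.
have gap0 : 0 < th * r ^+ 2 by rewrite mulr_gt0 // exprn_gt0.
have [u Fu uU] := perron_adherent (cl_sub Ox0) gap0.
have [cu su _ _] := Fu.
have uq y : enorm (y - x0) <= r -> 
    u y - quad_poly a b M' y <= - th * enorm (y - x0) ^+ 2.
  move=> yr; have [y1 y2] := ball y yr.
  have := hr2 y y2; have := perron_ge (cl_sub (r1O y y1)) Fu.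
  by rewrite -qE QM' sqr_enorm; lra.
pose A := [set y | enorm (y - x0) <= r].
have AO : A `<=` closure Omega by move=> y /ball[/r1O + _]; exact: cl_sub.
have x0A : A x0 by rewrite /A /= subrr enorm0 ltW.
have cuA : {within A, continuous (u - quad_poly a b M')}.
  apply: within_continuousB; first exact: continuous_subspaceW AO cu.
  by apply: continuous_subspaceT; exact: continuous_quad_poly.
have [y1 /set_mem Ay1 max1] :=
  EVT_max_rV (ex_intro _ _ x0A) (@compact_closed_eball _ _ x0 r) cuA.
have max2 y : A y -> u y - quad_poly a b M' y <= u y1 - quad_poly a b M' y1.
  by move=> Ay; apply: max1; rewrite inE.
have y1r : enorm (y1 - x0) < r.
  rewrite lt_neqAle Ay1 andbT; apply/eqP => y1E.
  have := max2 _ x0A; have := uq _ Ay1; rewrite y1E.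
  by rewrite -(qE x0) subrr dot0r quad_form0; lra.
have [y1r1 y1r2] := ball y1 Ay1.
have tu : touches_above u y1 (xi + (y1 - x0) *m (M' + M'^T)) M'.
  apply/nbhs_enormP; exists (r - enorm (y1 - x0)); first by rewrite subr_gt0.
  move=> y yr; have Ay : A y.
    by have := ler_distD_enorm y1 y x0; rewrite /A /=; lra.
  have := max2 y Ay; have := quad_poly_taylor a b M' y1 (y - y1).
  by rewrite (addrC y1) subrK gradE; lra.
have eta4 : 0 < eta / 2 / 2 by rewrite divr_gt0.
have [v [t [v0 t0 e]]] := su _ _ _ (r1O _ y1r1) tu _ eta4.
by have := open1 _ y1r1 v t v0 t0 e; lra.
Qed.

(** If the inequality failed at [x0], the quadratic touching the supremum from
    below, lowered away from [x0] and raised by [del], would be a subsolution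
    near [x0]; the maximum [V] of the two would belong to the family and exceed
    the supremum at [x0]. *)
Lemma perron_supersolution : subsolution Omega (- h) (- perron).
Proof.
move=> x0 xi M Ox0 tU eta eta0; apply: contrapT => noV.
have N v t : v != 0 -> 0 <= t -> xi = t *: v ->
    2 * quad_form M v + ((- h) x0 + eta) * dot v v < 0.
  move=> v0 t0 e; rewrite ltNge; apply/negP => pos; apply: noV.
  by exists v, t.
pose th := eta / 4; have th0 : 0 < th by rewrite divr_gt0.
have eta2 : 0 < eta / 2 by rewrite divr_gt0.
pose M' := M + th *: 1%:M.
have QM' w : quad_form M' w = quad_form M w + th * dot w w.
  by rewrite quad_formDl quad_formZl quad_form1.
have cNh : {within Omega, continuous (- h)} by move=> x; apply: cvgN; exact: ch.
have [r1 [r10 r1O open1]] : exists r, [/\ 0 < r,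
    forall y, enorm (y - x0) < r -> Omega y &
    forall y, enorm (y - x0) < r -> forall v t, v != 0 -> 0 <= t ->
      xi + (y - x0) *m (M' + M'^T) = t *: v ->
      2 * quad_form M' v + ((- h) y + eta / 2 / 2) * dot v v < 0].
  apply: (aligned_strict_open oO cNh Ox0 eta2) => v t v0 t0 e.
  by have := N v t v0 t0 e; rewrite QM' /th; lra.
have [r2 r20 hr2] := (nbhs_enormP _ _).1 tU.
pose r := Num.min r1 r2.
have r0 : 0 < r by rewrite lt_min r10.
have ball y : enorm (y - x0) < r -> enorm (y - x0) < r1 /\ enorm (y - x0) < r2.
  by rewrite lt_min => /andP.
pose del := th * (r / 2) ^+ 2.
have del0 : 0 < del by rewrite mulr_gt0 // exprn_gt0 // divr_gt0.
have [a [b [bE qE]]] := quad_poly_center (- perron x0 - del) xi M' x0.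
have gradE y : b + y *m (M' + M'^T) = xi + (y - x0) *m (M' + M'^T).
  have add_shift (p q s : 'rV[R]_n) : p + q = p + s + (q - s).
    by rewrite -addrA (addrC s) subrK.
  by rewrite mulmxBl -bE; exact: add_shift.
pose phi y := - quad_poly a b M' y.
have phi_lt y : enorm (y - x0) < r -> r / 2 <= enorm (y - x0) ->
    phi y <= perron y.
  move=> yr yr2; have [y1 y2] := ball y yr.
  have := hr2 y y2; rewrite /phi -qE QM' -sqr_enorm fctE.
  suff : del <= th * enorm (y - x0) ^+ 2 by lra.
  by rewrite ler_pM2l // ler_pXn2r ?nnegrE ?enorm_ge0 // divr_ge0 // ltW.
pose V y := if enorm (y - x0) < r then Num.max (perron y) (phi y) else perron y.
have VU y : perron y <= V y.
  by rewrite /V; case: ifP => // _; rewrite le_max lexx.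
have Vout y : r / 2 <= enorm (y - x0) -> V y = perron y.
  by move=> yr; rewrite /V; case: ifP => // yr'; rewrite max_l // phi_lt.
have FV : perron_family V.
  split.
  - apply/continuous_withinP => x cx e e0.
    have cphi : {within closure Omega, continuous phi}.
      have cq : {within closure Omega, continuous (quad_poly a b M')}.
        by apply: continuous_subspaceT; exact: continuous_quad_poly.
      by move=> y; apply: cvgN; exact: cq.
    have [xr|rx] := ltP (enorm (x - x0)) r.
      have [d d0 hd] := (continuous_withinP _ _).1
        (within_continuous_max perron_continuous cphi) x cx e e0.
      exists (Num.min d (r - enorm (x - x0))).
        by rewrite lt_min d0 subr_gt0.
      move=> y cy; rewrite lt_min => /andP[yd yr].
      have yr' : enorm (y - x0) < r by have := ler_distD_enorm x y x0; lra.
      by rewrite /V xr yr'; exact: hd.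
    have [d d0 hd] := (continuous_withinP _ _).1 perron_continuous x cx e e0.
    exists (Num.min d (r / 2)); first by rewrite lt_min d0 divr_gt0.
    move=> y cy; rewrite lt_min => /andP[yd yr]; rewrite !Vout; first exact: hd.
      by lra.
    by have := ler_distD_enorm y x x0; rewrite (enormBC x y); lra.
  - move=> x xi1 M1 Ox tV.
    have [Ve|Vne] := eqVneq (V x) (perron x).
      apply: perron_subsolution => //; apply: touches_above_le tV; last by [].
      by apply/nbhs_enormP; exists 1.
    have xr : enorm (x - x0) < r.
      rewrite ltNge; apply/negP => rx; move/eqP: Vne; apply.
      by apply: Vout; lra.
    have Vphi : V x = phi x.
      move: Vne; rewrite /V xr; case: (lerP (perron x) (phi x)) => // _.
      by rewrite eqxx.
    have [xr1 _] := ball x xr.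
    apply: (@touched_below_subsolution_at _ _ _ _
      (- (xi + (x - x0) *m (M' + M'^T))) (- M')) tV => //.
      rewrite !opprK; apply/nbhs_enormP; exists (r - enorm (x - x0)).
        by rewrite subr_gt0.
      move=> y yr; have yr' : enorm (y - x0) < r.
        by have := ler_distD_enorm x y x0; lra.
      have Vy : phi y <= V y by rewrite /V yr' le_max lexx orbT.
      have := quad_poly_taylor a b M' x (y - x).
      rewrite (addrC x) subrK gradE !fctE Vphi.
      by move: Vy; rewrite /phi; lra.
    move=> v t v0 t0 e; have nv0 : - v != 0 by rewrite oppr_eq0.
    have e' : xi + (x - x0) *m (M' + M'^T) = t *: - v.
      by rewrite scalerN -e opprK.
    have := open1 _ xr1 (- v) t nv0 t0 e'.
    rewrite quad_formNr quad_formNl dotNl dotNr opprK fctE.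
    have := mulr_ge0 (ltW eta0) (dotvv_ge0 v); lra.
  - move=> x bx; rewrite Vout ?perron_eq_boundary //.
    have : ~ enorm (x - x0) < r.
      by move=> /ball[/r1O Ox _]; exact: (boundary_not oO bx).
    by move/negP; rewrite -leNgt; lra.
  - move=> x cx; apply: le_trans (VU x).
    have [_ _ _ b1] := perron_family_paraboloid.
    apply: le_trans (b1 x cx) _; apply: perron_ge => //.
    exact: perron_family_paraboloid.
have := perron_ge (cl_sub Ox0) FV.
rewrite /V subrr enorm0 r0 ge_max /phi -qE subrr dot0r quad_form0.
by move=> /andP[_]; lra.
Qed.

Lemma perron_dirichlet_solution : dirichlet_solution Omega h g perron.
Proof.
split; [exact: perron_continuous| |exact: perron_eq_boundary].
apply/viscosity_solutionP => //; split.
- exact: continuous_subspaceW perron_continuous.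
- exact: perron_subsolution.
- exact: perron_supersolution.
Qed.

End Perron.

Lemma dirichlet_solution_exists (R : realType) (n : nat) (Omega : set 'rV[R]_n)
    (h g : 'rV[R]_n -> R) : (0 < n)%N -> open Omega -> bounded_set Omega ->
  {within Omega, continuous h} -> [bounded h x | x in Omega] ->
  {within boundary Omega, continuous g} ->
  exists u, dirichlet_solution Omega h g u.
Proof.
move=> n0 oO bO ch bh cg.
have [K K0 hK] : exists2 K, 0 < K & forall x, Omega x -> `|h x| < K.
  have [M [Mr hM]] := bh.
  have M1 : M < `|M| + 1 by have := ler_norm M; lra.
  exists (`|M| + 2) => [|x Ox]; first by have := normr_ge0 M; lra.
  by apply: le_lt_trans (hM _ M1 x Ox) _; lra.
have cK := compact_closure bO.
have [C C0 hC] : exists2 C, 0 < C & forall x, closure Omega x -> enorm x <= C.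
  have ce : {within closure Omega, continuous (fun x => enorm (x - 0))}.
    by apply: continuous_subspaceT; exact: continuous_enorm.
  have [C C0 hC] := continuous_compact_bounded cK ce.
  by exists C => // x cx; have := hC x cx; rewrite subr0 ger0_norm ?enorm_ge0.
have cB : compact (boundary Omega).
  apply: subclosed_compact cK _; last by move=> x [].
  rewrite /boundary setDE; apply: closedI; first exact: closed_closure.
  by apply: open_closedC; exact: open_interior.
have [Gam G0 hG] := continuous_compact_bounded cB cg.
exists (perron Omega h g K C Gam).
exact: perron_dirichlet_solution.
Qed.

(** * Countability of the exceptional set *)

Section Uniqueness.
Variables (R : realType) (n : nat).
Implicit Types (x y : 'rV[R]_n) (Omega : set 'rV[R]_n).
Implicit Types (f g u : 'rV[R]_n -> R).

Lemma within_continuousDr Omega f (c : R) : {within Omega, continuous f} ->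
  {within Omega, continuous (fun x => f x + c)}.
Proof. by move=> cf x; apply: cvgD; [exact: cf|exact: cvg_cst]. Qed.

Lemma dirichlet_comparison Omega f g (c c' : R) u (v : 'rV[R]_n -> R) :
  (0 < n)%N -> open Omega -> bounded_set Omega ->
  {within Omega, continuous f} -> c < c' ->
  dirichlet_solution Omega (fun x => f x + c) g u ->
  dirichlet_solution Omega (fun x => f x + c') g v ->
  forall x, closure Omega x -> u x <= v x.
Proof.
move=> n0 oO bO cf cc [cu /viscosity_solutionP[//|//|_ su _] ug].
move=> [cv /viscosity_solutionP[//|//|_ _ sv] vg].
apply: (@strict_comparison _ _ Omega (fun x => f x + c) (fun x => f x + c')
  u v (c' - c)) => //.
- exact: within_continuousDr.
- by rewrite subr_gt0.
- by move=> x _; lra.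
- by move=> x bx; rewrite ug // vg.
Qed.

Lemma dense_rat_vectors x (P : set 'rV[R]_n) : nbhs x P ->
  exists q : 'rV[rat]_n, P (map_mx ratr q).
Proof.
move=> /nbhs_ballP[r /= r0 hr].
have r2 : 0 < r / 2 by rewrite divr_gt0.
have H i : exists s : rat, `|x 0 i - ratr s| <= r / 2.
  have /rat_in_itvoo[s] : x 0 i - r / 2 < x 0 i + r / 2 by lra.
  by rewrite in_itv /= => hs; exists s; rewrite ler_norml; lra.
have [s hs] := choice H; exists (\row_i s i); apply: hr; rewrite -ball_normE /=.
apply: (@le_lt_trans _ _ (r / 2)); last by lra.
rewrite [leLHS]/Num.norm /= mx_normrE; apply: bigmax_le; first exact: ltW.
by move=> [i j] _ /=; rewrite (ord1 i) !mxE.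
Qed.

(** [q] records a rational point and a rational number lying strictly between
    the values there of two solutions for the same [c]. *)
Definition separated Omega f g (c : R) (q : 'rV[rat]_n * rat) : Prop :=
  exists u v, [/\ dirichlet_solution Omega (fun x => f x + c) g u,
    dirichlet_solution Omega (fun x => f x + c) g v,
    Omega (map_mx ratr q.1) &
    u (map_mx ratr q.1) < ratr q.2 < v (map_mx ratr q.1)].

Lemma separated_inj Omega f g (c c' : R) q :
  (0 < n)%N -> open Omega -> bounded_set Omega ->
  {within Omega, continuous f} ->
  separated Omega f g c q -> separated Omega f g c' q -> c = c'.
Proof.
move=> n0 oO bO cf.
suff lt_false a b : a < b -> separated Omega f g a q ->
    separated Omega f g b q -> False.
  move=> sc sc'; case: (ltgtP c c') => // cc; first by case: (lt_false _ _ cc).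
  by case: (lt_false _ _ cc).
move=> ab [u [v [_ sv Oq /andP[_ qv]]]] [u' [v' [su' _ _ /andP[uq _]]]].
have := dirichlet_comparison n0 oO bO cf ab sv su' (subset_closure Oq).
lra.
Qed.

Lemma separatedP Omega f g (c : R) u (v : 'rV[R]_n -> R) x :
  open Omega ->
  dirichlet_solution Omega (fun x => f x + c) g u ->
  dirichlet_solution Omega (fun x => f x + c) g v ->
  closure Omega x -> v x <> u x -> exists q, separated Omega f g c q.
Proof.
move=> oO su sv cx vu.
wlog uv : u v su sv vu / u x < v x.
  move=> H; case: (ltgtP (u x) (v x)) => [uv|uv|/esym //].
    exact: (H u v).
  by apply: (H v u) => // /esym.
have [cu [cOu _] ug] := su; have [cv [cOv _] vg] := sv.
have Ox : Omega x.
  by apply: closure_sub_boundary => // bx; apply: vu; rewrite ug // vg.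
have /rat_in_itvoo[q] := uv; rewrite in_itv /= => /andP[uq qv].
have uq0 : 0 < ratr q - u x by rewrite subr_gt0.
have qv0 : 0 < v x - ratr q by rewrite subr_gt0.
have [d d0 hd] := (continuous_withinP _ _).1 cOu x Ox _ uq0.
have [d' d0' hd'] := (continuous_withinP _ _).1 cOv x Ox _ qv0.
have [r r0 hr] := (nbhs_enormP _ _).1 (open_nbhs_nbhs (conj oO Ox)).
have nb : nbhs x [set y | Omega y /\ u y < ratr q < v y].
  apply/nbhs_enormP; exists (Num.min r (Num.min d d')).
    by rewrite !lt_min r0 d0.
  move=> y; rewrite !lt_min => /and3P[yr yd yd'].
  have Oy := hr y yr; have := hd y Oy yd; have := hd' y Oy yd'.
  by rewrite !ltr_norml => h1 h2; split=> //; lra.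
have [X [OX hX]] := dense_rat_vectors nb.
by exists (X, q), u, v.
Qed.

End Uniqueness.

Theorem theorem2p16 (R : realType) (n : nat) (n_gt0 : (0 < n)%N)
  (Omega : set 'rV[R]_n)
  (Omega_bounded : bounded_set Omega)
  (Omega_connected : connected Omega)
  (Omega_open : open Omega)
  (Omega_diam : (path_diam Omega < +oo)%E)
  (f g : 'rV[R]_n -> R)
  (f_cont : {within Omega, continuous f})
  (f_bounded : [bounded f x | x in Omega])
  (g_cont : {within boundary Omega, continuous g}) :
  exists N : set R, countable N /\
    forall c : R, ~ N c ->
      exists u : 'rV[R]_n -> R,
        dirichlet_solution Omega (fun x => f x + c) g u /\
        forall v : 'rV[R]_n -> R,
          dirichlet_solution Omega (fun x => f x + c) g v ->
          forall x, closure Omega x -> v x = u x.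
Proof.
pose N := [set c | exists q, separated Omega f g c q].
exists N; split.
  have pick c : exists q, N c -> separated Omega f g c q.
    by have [[q hq]|nN] := pselect (N c); [exists q|exists (0, 0)].
  have [F hF] := choice pick.
  apply/countable_injP; exists (fun c => pickle (F c)) => c c'.
  move=> /set_mem Nc /set_mem Nc' /(pcan_inj pickleK) FE.
  apply: (separated_inj n_gt0 Omega_open Omega_bounded f_cont (hF c Nc)).
  by rewrite FE; exact: hF.
move=> c nNc.
have fc_cont : {within Omega, continuous (fun x => f x + c)}.
  exact: within_continuousDr.
have fc_bounded : [bounded f x + c | x in Omega].
  have [M [Mr hM]] := f_bounded; exists (M + `|c|); split=> [|r rM x Ox /=].
    exact: num_real.
  have Mr' : M < r - `|c| by rewrite ltrBrDr.
  by apply: le_trans (ler_normD _ _) _; have /= := hM _ Mr' x Ox; lra.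
have [u su] := dirichlet_solution_exists n_gt0 Omega_open Omega_bounded
  fc_cont fc_bounded g_cont.
exists u; split=> // v sv x cx; apply: contrapT => vu; apply: nNc.
exact: (separatedP Omega_open su sv cx vu).
Qed.
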